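(* Let $(A,\cdot,\{,\}_A,d_A)$ and $(B,\ast,\{,\}_B,d_B)$ be any two differential graded Poisson algebras over a field $\Bbbk$. Then $(A\otimes B,\star,\{,\},d)$ is a differential graded Poisson algebra, where $$(a\otimes b)\star(a'\otimes b'):=(-1)^{|a'||b|}(a\cdot a')\otimes(b\ast b'),$$ $$d(a\otimes b):=d_A(a)\otimes b+(-1)^{|a|}a\otimes d_B(b),$$ $$\{a\otimes b,a'\otimes b'\}:=(-1)^{|a'||b|}\left(\{a,a'\}_A\otimes(b\ast b')+(a\cdot a')\otimes\{b,b'\}_B\right),$$ for any homogeneous elements $a,a'\in A$ and $b,b'\in B$. Moreover, the category of differential graded Poisson algebras is a symmetric monoidal category (with this tensor product) with left and right identity $\Bbbk$.
   Context: Everything is over a field $\Bbbk$; all algebras have an identity and maps of algebras preserve it; gradings are by $\mathbb{Z}$ and $|x|$ is the degree of a homogeneous element $x$. A differential graded (DG) algebra is a graded algebra with a linear map $d$ of degree $1$ with $d^2=0$ and $d(ab)=d(a)b+(-1)^{|a|}a\,d(b)$ for homogeneous $a,b$. A DG Poisson algebra $(A,\cdot,\{,\},d)$ is a DG algebra $(A,\cdot,d)$ with $ab=(-1)^{|a||b|}ba$ and a degree $0$ linear bracket $\{,\}:A\otimes A\to A$ such that for homogeneous $a,b,c$: $\{a,b\}=-(-1)^{|a||b|}\{b,a\}$; $\{a,\{b,c\}\}=\{\{a,b\},c\}+(-1)^{|a||b|}\{b,\{a,c\}\}$; $\{a,bc\}=\{a,b\}c+(-1)^{|a||b|}b\{a,c\}$;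 $d(\{a,b\})=\{d(a),b\}+(-1)^{|a|}\{a,d(b)\}$. Morphisms of DG Poisson algebras are degree $0$ graded algebra maps commuting with the differentials and preserving the brackets. $\Bbbk$ is a DG Poisson algebra concentrated in degree $0$ with zero differential and bracket. The symmetry is $\varphi:A\otimes B\to B\otimes A$, $\varphi(a\otimes b)=(-1)^{|a||b|}b\otimes a$. *)

(* Defs.v *)
From HB Require Import structures.
From mathcomp Require Import all_boot all_order all_algebra.
From mathcomp Require Import generic_quotient ring_quotient freeg.
From mathcomp Require Import boolp.

Set Implicit Arguments.
Unset Strict Implicit.
Unset Printing Implicit Defensive.

Import GRing.Theory.
Local Open Scope ring_scope.
Local Open Scope quotient_scope.

(* The tensor product over k of two vector spaces of arbitrary dimension: the *)
(* free vector space on the set A * B modulo the bilinearity relations.       *)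

Section Tensor.
Variables (k : fieldType) (A B : lmodType k).

Local Notation free := {freeg (A * B)%type / k}.

Inductive tensor_rel : free -> Prop :=
| tensor_rel_addl a a' b :
    tensor_rel (<< (a + a', b) >> - (<< (a, b) >> + << (a', b) >>))
| tensor_rel_addr a b b' :
    tensor_rel (<< (a, b + b') >> - (<< (a, b) >> + << (a, b') >>))
| tensor_rel_scalel c a b :
    tensor_rel (<< (c *: a, b) >> - c *: << (a, b) >>)
| tensor_rel_scaler c a b :
    tensor_rel (<< (a, c *: b) >> - c *: << (a, b) >>)
| tensor_rel0 : tensor_rel 0
| tensor_rel_lin c x y :
    tensor_rel x -> tensor_rel y -> tensor_rel (c *: x + y).

Definition tensor_ker (x : free) : bool := `[< tensor_rel x >].

Fact tensor_ker_zmod_closed : zmod_closed tensor_ker.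
Proof.
split=> [|x y /asboolP xP /asboolP yP]; first exact/asboolP/tensor_rel0.
by apply/asboolP; rewrite -[x - y]addrC -scaleN1r; apply: tensor_rel_lin.
Qed.
HB.instance Definition _ :=
  GRing.isZmodClosed.Build free tensor_ker tensor_ker_zmod_closed.

Local Notation tensor_ideal := (GRing.ZmodClosed.clone free tensor_ker _).

Definition tensor : Type := Quotient.quot tensor_ideal.
HB.instance Definition _ := GRing.Zmodule.on tensor.

Definition tensor_pi (x : free) : tensor := \pi_(Quotient.quot tensor_ideal) x.

Fact tensor_piP x y : tensor_pi x = tensor_pi y <-> tensor_rel (x - y).
Proof.
rewrite /tensor_pi; split=> [/eqP|xy].
  by rewrite -Quotient.idealrBE => /asboolP.
by apply/eqP; rewrite -Quotient.idealrBE; apply/asboolP.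
Qed.

Fact tensor_piD x y : tensor_pi (x + y) = tensor_pi x + tensor_pi y.
Proof. exact: (raddfD (\pi_(Quotient.quot tensor_ideal))). Qed.

Fact tensor_reprK (x : tensor) : tensor_pi (repr x) = x.
Proof. exact: reprK. Qed.

Definition tensor_scale (c : k) (x : tensor) : tensor := tensor_pi (c *: repr x).

Fact tensor_piZ c x : tensor_pi (c *: x) = tensor_scale c (tensor_pi x).
Proof.
apply/tensor_piP; rewrite -scalerBr -[X in tensor_rel X]addr0.
apply: tensor_rel_lin (tensor_rel0); apply/tensor_piP.
by rewrite tensor_reprK.
Qed.

Fact tensor_scaleA b c x :
  tensor_scale b (tensor_scale c x) = tensor_scale (b * c) x.
Proof. by rewrite -[x]tensor_reprK -!tensor_piZ scalerA. Qed.

Fact tensor_scale1 : left_id 1 tensor_scale.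
Proof. by move=> x; rewrite -[x]tensor_reprK -tensor_piZ scale1r. Qed.

Fact tensor_scaleDr : right_distributive tensor_scale +%R.
Proof.
move=> c x y; rewrite -[x]tensor_reprK -[y]tensor_reprK.
by rewrite -tensor_piD -!tensor_piZ -tensor_piD scalerDr.
Qed.

Fact tensor_scaleDl x : {morph tensor_scale^~ x : b c / b + c}.
Proof.
by move=> b c; rewrite -[x]tensor_reprK -!tensor_piZ -tensor_piD scalerDl.
Qed.

HB.instance Definition _ := GRing.Zmodule_isLmodule.Build k tensor
  tensor_scaleA tensor_scale1 tensor_scaleDr tensor_scaleDl.

Definition tens (a : A) (b : B) : tensor := tensor_pi << (a, b) >>.

Fact tensor_pi_linear : linear tensor_pi.
Proof. by move=> c x y; rewrite tensor_piD tensor_piZ. Qed.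
HB.instance Definition _ :=
  GRing.isLinear.Build k free tensor *:%R tensor_pi tensor_pi_linear.

Fact tens_is_bilinear : bilinear_for *:%R *:%R tens.
Proof.
split=> [b c x y|a c x y] /=; rewrite /tens -tensor_pi_linear.
  transitivity (tensor_pi (<< (c *: x, b) >> + << (y, b) >>)).
    exact/tensor_piP/tensor_rel_addl.
  by rewrite !tensor_piD; congr (_ + _); apply/tensor_piP/tensor_rel_scalel.
transitivity (tensor_pi (<< (a, c *: x) >> + << (a, y) >>)).
  exact/tensor_piP/tensor_rel_addr.
by rewrite !tensor_piD; congr (_ + _); apply/tensor_piP/tensor_rel_scaler.
Qed.
HB.instance Definition _ :=
  bilinear_isBilinear.Build k A B tensor *:%R *:%R tens tens_is_bilinear.

Lemma tensor_span (x : tensor) :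
  exists s : seq (A * B), x = \sum_(p <- s) tens p.1 p.2.
Proof.
rewrite -[x]tensor_reprK -[repr x](freeg_sumE) linear_sum /=.
exists [seq (coeff z (repr x) *: z.1, z.2) | z <- dom (repr x)].
rewrite [RHS]big_map; apply: eq_bigr => -[a b] _ /=.
rewrite linearZl_LR /= /tens -linearZ /=; congr tensor_pi.
by apply/eqP/freeg_eqP => z; rewrite coeffZ !coeffU mul1r.
Qed.

Lemma tensor_universal (W : lmodType k) (f : {bilinear A -> B -> W}) :
  exists2 g : {linear tensor -> W}, (forall a b, g (tens a b) = f a b)
    & forall g' : {linear tensor -> W},
        (forall a b, g' (tens a b) = f a b) -> g' =1 g.
Proof.
pose F : free -> W := fglift (fun p => f p.1 p.2).
have FD : {morph F : x y / x - y}.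
  exact: (@lift_is_additive _ _ W (fun p => f p.1 p.2)).
have F0 : F 0 = 0 by rewrite -(subrr 0) FD subrr.
have FA : {morph F : x y / x + y}.
  by move=> x y; rewrite -{1}[y]opprK -[- y]sub0r !FD F0 sub0r opprK.
have FU c p : F << c *g p >> = c *: f p.1 p.2 by rewrite /F liftU.
have Fsum (r : seq (A * B)) (h : A * B -> free) :
  F (\sum_(i <- r) h i) = \sum_(i <- r) F (h i) by apply: big_morph.
have FZ c : {morph F : x / c *: x}.
  move=> x; rewrite -[x]freeg_sumE scaler_sumr !Fsum scaler_sumr.
  apply: eq_bigr => p _.
  rewrite (_ : c *: << coeff p x *g p >> = << c * coeff p x *g p >>).
    by rewrite !FU scalerA.
  by apply/eqP/freeg_eqP => z; rewrite coeffZ !coeffU mulrA.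
have Frel x : tensor_rel x -> F x = 0.
  elim=> [a a' b|a b b'|c a b|c a b||c {}x y _ Fx _ Fy] //.
  - by rewrite FD FA !FU !scale1r linearDl subrr.
  - by rewrite FD FA !FU !scale1r linearDr subrr.
  - by rewrite FD FZ !FU !scale1r linearZl_LR subrr.
  - by rewrite FD FZ !FU !scale1r linearZr_LR subrr.
  - by rewrite FA FZ Fx Fy scaler0 addr0.
pose G (x : tensor) : W := F (repr x).
have GE x : G (tensor_pi x) = F x.
  apply/eqP; rewrite -subr_eq0 -FD; apply/eqP/Frel/tensor_piP.
  by rewrite tensor_reprK.
have Glin : linear G.
  move=> c x y; rewrite -[x]tensor_reprK -[y]tensor_reprK.
  by rewrite -[c *: tensor_pi _]linearZ -linearD !GE FA FZ.
pose gm := GRing.isLinear.Build k tensor W *:%R G Glin.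
pose g : {linear tensor -> W} := HB.pack G gm.
have gE a b : g (tens a b) = f a b by rewrite /= GE FU scale1r.
exists g => // g' g'E x; have [s ->] := tensor_span x.
by rewrite !linear_sum; apply: eq_bigr => p _; rewrite gE g'E.
Qed.

End Tensor.

Notation "A \ox B" := (tensor A B) (at level 40, left associativity) : type_scope.
Notation "a \ox b" := (tens a b) (at level 40, left associativity) : ring_scope.

(* Degrees are witnessed by a predicate homog, [homog n x] meaning that x     *)
(* lies in the component of degree n; the zero vector lies in all of them.    *)

Record is_grading (k : fieldType) (V : lmodType k) (homog : int -> V -> Prop) :
    Prop := IsGrading {
  grading0 : forall n, homog n 0;
  grading_lin : forall n c x y, homog n x -> homog n y -> homog n (c *: x + y);
  grading_span : forall x, exists s (f : int -> V),
    (forall n, homog n (f n)) /\ x = \sum_(n <- s) f n;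
  grading_free : forall (s : seq int) (f : int -> V), uniq s ->
    (forall n, homog n (f n)) -> \sum_(n <- s) f n = 0 ->
    forall n, n \in s -> f n = 0
}.

Record is_graded_algebra (k : fieldType) (V : lmodType k)
    (homog : int -> V -> Prop) (one : V) (mul : V -> V -> V) :
    Prop := IsGradedAlgebra {
  graded_grading : is_grading homog;
  graded_mul_bilinear : bilinear_for *:%R *:%R mul;
  graded_mulA : associative mul;
  graded_mul1l : left_id one mul;
  graded_mul1r : right_id one mul;
  graded_homog1 : homog 0 one;
  graded_homogM : forall i j a b,
    homog i a -> homog j b -> homog (i + j) (mul a b)
}.

Record is_dg_algebra (k : fieldType) (V : lmodType k)
    (homog : int -> V -> Prop) (one : V) (mul : V -> V -> V) (d : V -> V) :
    Prop := IsDGAlgebra {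
  dg_graded_algebra : is_graded_algebra homog one mul;
  dg_diff_linear : linear d;
  dg_homog_diff : forall i a, homog i a -> homog (i + 1) (d a);
  dg_diff2 : forall a, d (d a) = 0;
  dg_diffM : forall i j a b, homog i a -> homog j b ->
    d (mul a b) = mul (d a) b + (-1) ^ i *: mul a (d b)
}.

Record is_dg_poisson (k : fieldType) (V : lmodType k)
    (homog : int -> V -> Prop) (one : V) (mul br : V -> V -> V) (d : V -> V) :
    Prop := IsDGPoisson {
  dgp_dg_algebra : is_dg_algebra homog one mul d;
  dgp_mulC : forall i j a b, homog i a -> homog j b ->
    mul a b = (-1) ^ (i * j) *: mul b a;
  dgp_br_bilinear : bilinear_for *:%R *:%R br;
  dgp_homog_br : forall i j a b,
    homog i a -> homog j b -> homog (i + j) (br a b);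
  dgp_br_anti : forall i j a b, homog i a -> homog j b ->
    br a b = - ((-1) ^ (i * j) *: br b a);
  dgp_jacobi : forall i j l a b c, homog i a -> homog j b -> homog l c ->
    br a (br b c) = br (br a b) c + (-1) ^ (i * j) *: br b (br a c);
  dgp_leibniz : forall i j l a b c, homog i a -> homog j b -> homog l c ->
    br a (mul b c) = mul (br a b) c + (-1) ^ (i * j) *: mul b (br a c);
  dgp_diff_br : forall i j a b, homog i a -> homog j b ->
    d (br a b) = br (d a) b + (-1) ^ i *: br a (d b)
}.

(* A DG Poisson algebra is a vector space together with a structure on it.    *)
(* The library algebras are not used because they require 1 <> 0.             *)

Record dgPoisson_on (k : fieldType) (V : lmodType k) : Type := DGPoissonOn {
  homog : int -> V -> Prop;
  dg_one : V;
  dg_mul : V -> V -> V;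
  dg_br : V -> V -> V;
  dg_diff : V -> V;
  dgPoisson_axioms : is_dg_poisson homog dg_one dg_mul dg_br dg_diff
}.

Record dgPoisson (k : fieldType) : Type := DGPoisson {
  dg_space :> lmodType k;
  dg_struct :> dgPoisson_on dg_space
}.

Record is_dgp_morphism (k : fieldType) (A B : dgPoisson k) (f : A -> B) :
    Prop := IsDGPMorphism {
  dgp_morph_linear : linear f;
  dgp_morph_homog : forall n a, homog A n a -> homog B n (f a);
  dgp_morph1 : f (dg_one A) = dg_one B;
  dgp_morphM : forall a b, f (dg_mul A a b) = dg_mul B (f a) (f b);
  dgp_morph_br : forall a b, f (dg_br A a b) = dg_br B (f a) (f b);
  dgp_morph_diff : forall a, f (dg_diff A a) = dg_diff B (f a)
}.

Record dgp_hom (k : fieldType) (A B : dgPoisson k) : Type := DGPHom {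
  dgp_fun :> A -> B;
  dgp_funP : is_dgp_morphism dgp_fun
}.

Section GroundField.
Variable k : fieldType.

Definition ground_homog (n : int) (x : k^o) : Prop := n = 0 \/ x = 0.

Fact ground_grading : is_grading ground_homog.
Proof.
split=> [n|n c x y|x|s f Us hf]; first by right.
- case=> [-> _|->]; first by left.
  by case=> [->|->]; [left | right; rewrite scaler0 addr0].
- exists [:: 0], (fun n => if n == 0 then x else 0); split=> [n|].
    by case: eqP => [->|_]; [left | right].
  by rewrite big_seq1 eqxx.
- have f0 n : n != 0 -> f n = 0 by case: (hf n) => [->|]; rewrite ?eqxx.
  move=> sum0 n ns; have [n0|] := eqVneq n 0; last exact: f0.
  move: sum0; rewrite (bigD1_seq n) //= big1 ?addr0 // => i ni.
  by apply: f0; rewrite -n0.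
Qed.

Fact ground_graded_algebra : @is_graded_algebra k k^o ground_homog 1 *%R.
Proof.
split; [exact: ground_grading | | exact: mulrA | exact: mul1r | exact: mulr1
       | by left |].
  split=> [b c x y|a c x y] /=; first by rewrite mulrDl -scalerAl.
  by rewrite mulrDr -scalerAr.
move=> i j a b; case=> [->|->]; last by rewrite mul0r; right.
by case=> [->|->]; [left | rewrite mulr0; right].
Qed.

Fact ground_axioms :
  @is_dg_poisson k k^o ground_homog 1 *%R (fun _ _ => 0) (fun _ => 0).
Proof.
split.
- split; first exact: ground_graded_algebra.
  + by move=> c x y; rewrite scaler0 addr0.
  + by move=> *; right.
  + by [].
  + by move=> *; rewrite mul0r mulr0 scaler0 addr0.
- move=> i j a b; case=> [->|->]; last by rewrite mul0r mulr0 scaler0.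
  by rewrite mul0r expr0z scale1r mulrC.
- by split=> [b c x y|a c x y] /=; rewrite scaler0 addr0.
- by move=> *; right.
- by move=> *; rewrite scaler0 oppr0.
- by move=> *; rewrite scaler0 addr0.
- by move=> *; rewrite mul0r mulr0 scaler0 addr0.
- by move=> *; rewrite scaler0 addr0.
Qed.

Definition ground_dgPoisson : dgPoisson k :=
  DGPoisson (DGPoissonOn ground_axioms).

End GroundField.

(* Categories; comp g f is the composite g after f. *)

Record category : Type := Category {
  obj :> Type;
  hom : obj -> obj -> Type;
  idc : forall X, hom X X;
  comp : forall X Y Z, hom Y Z -> hom X Y -> hom X Z;
  comp1l : forall X Y (f : hom X Y), comp (idc Y) f = f;
  comp1r : forall X Y (f : hom X Y), comp f (idc X) = f;
  compA : forall X Y Z T (h : hom Z T) (g : hom Y Z) (f : hom X Y),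
    comp h (comp g f) = comp (comp h g) f
}.

Arguments hom {c} _ _.
Arguments idc {c} X.
Arguments comp {c X Y Z} g f.

Declare Scope cat_scope.
Delimit Scope cat_scope with cat.
Notation "g \o f" := (comp g f) : cat_scope.

Definition is_iso (C : category) (X Y : C) (f : hom X Y) : Prop :=
  exists g : hom Y X, (g \o f)%cat = idc X /\ (f \o g)%cat = idc Y.

(* Symmetric monoidal structures with prescribed tensor product of objects    *)
(* and prescribed unit object.                                                *)

Section SymmetricMonoidal.
Local Open Scope cat_scope.
Variables (C : category) (tensor_obj : C -> C -> C) (I : C).
Local Notation "X <*> Y" := (tensor_obj X Y) (at level 40, left associativity).

Record symmetric_monoidal : Type := SymmetricMonoidal {
  tensor_map : forall X X' Y Y',
    hom X X' -> hom Y Y' -> hom (X <*> Y) (X' <*> Y');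
  associator : forall X Y Z, hom ((X <*> Y) <*> Z) (X <*> (Y <*> Z));
  left_unitor : forall X, hom (I <*> X) X;
  right_unitor : forall X, hom (X <*> I) X;
  braiding : forall X Y, hom (X <*> Y) (Y <*> X);

  tensor_map_id : forall X Y, tensor_map (idc X) (idc Y) = idc (X <*> Y);
  tensor_map_comp : forall X X' X'' Y Y' Y''
      (f' : hom X' X'') (f : hom X X') (g' : hom Y' Y'') (g : hom Y Y'),
    tensor_map (f' \o f) (g' \o g) = tensor_map f' g' \o tensor_map f g;

  associator_natural : forall X X' Y Y' Z Z'
      (f : hom X X') (g : hom Y Y') (h : hom Z Z'),
    associator X' Y' Z' \o tensor_map (tensor_map f g) h
    = tensor_map f (tensor_map g h) \o associator X Y Z;
  left_unitor_natural : forall X X' (f : hom X X'),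
    left_unitor X' \o tensor_map (idc I) f = f \o left_unitor X;
  right_unitor_natural : forall X X' (f : hom X X'),
    right_unitor X' \o tensor_map f (idc I) = f \o right_unitor X;
  braiding_natural : forall X X' Y Y' (f : hom X X') (g : hom Y Y'),
    braiding X' Y' \o tensor_map f g = tensor_map g f \o braiding X Y;

  associator_iso : forall X Y Z, is_iso (associator X Y Z);
  left_unitor_iso : forall X, is_iso (left_unitor X);
  right_unitor_iso : forall X, is_iso (right_unitor X);

  pentagon : forall X Y Z T,
    associator X Y (Z <*> T) \o associator (X <*> Y) Z T
    = tensor_map (idc X) (associator Y Z T)
        \o (associator X (Y <*> Z) T \o tensor_map (associator X Y Z) (idc T));
  triangle : forall X Y,
    tensor_map (idc X) (left_unitor Y) \o associator X I Y
    = tensor_map (right_unitor X) (idc Y);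
  hexagon : forall X Y Z,
    associator Y Z X \o (braiding X (Y <*> Z) \o associator X Y Z)
    = tensor_map (idc Y) (braiding X Z)
        \o (associator Y X Z \o tensor_map (braiding X Y) (idc Z));
  braiding_symmetric : forall X Y, braiding Y X \o braiding X Y = idc (X <*> Y)
}.

End SymmetricMonoidal.

Section DGPoissonCategory.
Variable k : fieldType.

Lemma dgp_hom_ext (A B : dgPoisson k) (f g : dgp_hom A B) : f =1 g -> f = g.
Proof.
case: f g => [f fP] [g gP] /= /funext fg.
by subst g; congr DGPHom; apply: Prop_irrelevance.
Qed.

Fact dgp_id_morphism (A : dgPoisson k) : is_dgp_morphism (@id A).
Proof. by split. Qed.

Definition dgp_id (A : dgPoisson k) : dgp_hom A A :=
  DGPHom (dgp_id_morphism A).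

Fact dgp_comp_morphism (A B C : dgPoisson k) (g : dgp_hom B C)
  (f : dgp_hom A B) : is_dgp_morphism (g \o f).
Proof.
case: f g => [f [f1 f2 f3 f4 f5 f6]] [g [g1 g2 g3 g4 g5 g6]].
split=> [c x y|n a /f2 /g2 //||a b|a b|a] /=.
- by rewrite f1 g1.
- by rewrite f3 g3.
- by rewrite f4 g4.
- by rewrite f5 g5.
- by rewrite f6 g6.
Qed.

Definition dgp_comp (A B C : dgPoisson k) (g : dgp_hom B C) (f : dgp_hom A B) :
  dgp_hom A C := DGPHom (dgp_comp_morphism g f).

Fact dgp_comp1l (A B : dgPoisson k) (f : dgp_hom A B) :
  dgp_comp (dgp_id B) f = f.
Proof. exact: dgp_hom_ext. Qed.

Fact dgp_comp1r (A B : dgPoisson k) (f : dgp_hom A B) :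
  dgp_comp f (dgp_id A) = f.
Proof. exact: dgp_hom_ext. Qed.

Fact dgp_compA (A B C D : dgPoisson k) (h : dgp_hom C D) (g : dgp_hom B C)
  (f : dgp_hom A B) : dgp_comp h (dgp_comp g f) = dgp_comp (dgp_comp h g) f.
Proof. exact: dgp_hom_ext. Qed.

Definition dgPoissonCat : category :=
  Category dgp_comp1l dgp_comp1r dgp_compA.

End DGPoissonCategory.

(* The component of degree n of A \ox B is spanned by the a \ox b with        *)
(* |a| + |b| = n.                                                             *)
Definition tensor_homog (k : fieldType) (A B : dgPoisson k) (n : int)
    (x : A \ox B) : Prop :=
  exists s : seq (A * B),
    (forall p, p \in s ->
       exists i j, [/\ i + j = n, homog A i p.1 & homog B j p.2])
    /\ x = \sum_(p <- s) p.1 \ox p.2.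

(* Main.v *)
(** Every homogeneous formula involving a Koszul sign is realised by a linear map
    on the algebraic tensor product by splitting one factor into its even and odd
    parts and letting (-1)^|a| act on the other. All the axioms, and the coherence
    diagrams, are equalities of multilinear maps, so it suffices to check them on
    tensors of homogeneous elements; there each reduces to the axioms of A and B
    and to an identity between signs, decided by the parities of the degrees. *)

Require Import Defs.
From HB Require Import structures.
From mathcomp Require Import all_boot all_order all_algebra.
From mathcomp Require Import boolp zify.

Set Implicit Arguments.
Unset Strict Implicit.
Unset Printing Implicit Defensive.

Import GRing.Theory.
Local Open Scope ring_scope.

(** * Gradings and linear maps on tensor products *)

(** A grading is only a predicate on elements: no projection onto a component is given, and a
    formula such as (-1)^|a| a says nothing about a non-homogeneous a. The operator [hpart] fills
    this gap. It sums the components selected by a set of degrees, taken from a decomposition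
    obtained by choice; the independence axiom of gradings makes the result independent of that
    choice, hence linear. Since a sign sees a degree modulo 2 only, the even and the odd projection
    are enough to turn each signed formula into a total linear map.

    Two points go beyond comparing signs. Independence of the components of different total degree
    is not an identity between multilinear maps; it is obtained by separating the components with
    finitely many products of projections. In the Jacobi identity, mixed terms appear on the right
    that have no counterpart on the left and have to cancel among themselves. *)

Definition oddz (m : int) : bool := odd `|m|%N.

Lemma oddzD m n : oddz (m + n) = oddz m (+) oddz n.
Proof. by rewrite /oddz; lia. Qed.

Lemma oddzM m n : oddz (m * n) = oddz m && oddz n.
Proof. by rewrite /oddz abszM oddM. Qed.

Lemma signz_oddz (R : unitRingType) m : (-1) ^ m = (-1) ^+ oddz m :> R.
Proof.
rewrite /oddz; case: m => m; first by rewrite signr_odd.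
by rewrite NegzE abszN signr_odd -exprnN -exprVn invrN1.
Qed.

Lemma oddz1 : oddz 1 = true. Proof. by []. Qed.

Definition signzE := (signz_oddz, oddzD, oddzM, oddz1).

Section Grading.
Variables (k : fieldType) (V : lmodType k) (homog : int -> V -> Prop).
Hypothesis G : is_grading homog.

(** Extension by zero: it lets two decompositions with different index lists be compared over one
    list containing both. *)
Let ext (s : seq int) (f : int -> V) n := if n \in s then f n else 0.

Let homog_ext s f n : (forall n, homog n (f n)) -> homog n (ext s f n).
Proof. by move=> hf; rewrite /ext; case: ifP => // _; apply: (grading0 G). Qed.

Let sum_ext (P : pred int) s t f : uniq s -> uniq t -> {subset s <= t} ->
  \sum_(n <- t | P n) ext s f n = \sum_(n <- s | P n) f n.
Proof.
move=> Us Ut st; rewrite /ext -big_mkcondr /= -big_filter.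
rewrite -[RHS]big_filter; apply: perm_big; apply: uniq_perm.
- exact: filter_uniq.
- exact: filter_uniq.
move=> n; rewrite !mem_filter; have [ns|_] := boolP (n \in s).
  by rewrite st // andbT.
by rewrite andbF.
Qed.

(** The spanning axiom allows repeated degrees while independence needs distinct ones, so
    repetitions are merged: a degree listed m times contributes m copies of the same [f n]. *)
Lemma homog_decomp x : exists D : seq int * (int -> V),
  [/\ uniq D.1, forall n, homog n (D.2 n) & x = \sum_(n <- D.1) D.2 n].
Proof.
have [s [f [hf ->]]] := grading_span G x.
exists (undup s, fun n => f n *+ count_mem n s); split=> /= [|n|].
- exact: undup_uniq.
- elim: (count_mem _ _) => [|m IH]; first by rewrite mulr0n; apply: (grading0 G).
  by rewrite mulrS -[X in X + _]scale1r; apply: (grading_lin G).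
by rewrite -[LHS](@big_undup_iterop_count _ _ +%R).
Qed.

(** An arbitrary decomposition picked by choice; [hpart_sum] shows that the pick does not matter. *)
Let decomp x := sval (cid (homog_decomp x)).

Definition hpart (P : pred int) (x : V) : V :=
  \sum_(n <- (decomp x).1 | P n) (decomp x).2 n.

(** Both the chosen decomposition and the given one are extended by zero to a common list [u]. Their
    difference is a family of homogeneous elements with sum 0, so it vanishes degree by degree. *)
Lemma hpart_sum (P : pred int) s f : uniq s -> (forall n, homog n (f n)) ->
  hpart P (\sum_(n <- s) f n) = \sum_(n <- s | P n) f n.
Proof.
move=> Us hf; rewrite /hpart /decomp; case: cid => -[t g] /= [Ut hg fg].
have Uu := undup_uniq (s ++ t); set u := undup _ in Uu.
have su : {subset s <= u} by move=> n; rewrite mem_undup mem_cat => ->.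
have tu : {subset t <= u} by move=> n; rewrite mem_undup mem_cat orbC => ->.
rewrite -(sum_ext P f Us Uu su) -(sum_ext P g Ut Uu tu).
rewrite big_seq_cond [RHS]big_seq_cond; apply: eq_bigr => n /andP[nu _].
apply/esym/eqP; rewrite -subr_eq0; apply/eqP; move: n nu.
apply: (grading_free G (f := fun n => ext s f n - ext t g n)) => // [n|].
  by rewrite addrC -scaleN1r; apply: (grading_lin G); apply: homog_ext.
by rewrite sumrB !sum_ext // fg subrr.
Qed.

Lemma hpart_linear P : linear (hpart P).
Proof.
move=> c x y; have [[s f] /= [Us hf ->]] := homog_decomp x.
have [[t g] /= [Ut hg ->]] := homog_decomp y.
have Uu := undup_uniq (s ++ t); set u := undup _ in Uu.
have su : {subset s <= u} by move=> n; rewrite mem_undup mem_cat => ->.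
have tu : {subset t <= u} by move=> n; rewrite mem_undup mem_cat orbC => ->.
(* Over the common list [u], c x + y is visibly the sum of the elements c f(n) + g(n), a
   decomposition to which [hpart_sum] applies. *)
rewrite !hpart_sum // -(sum_ext xpredT f Us Uu su) -(sum_ext xpredT g Ut Uu tu).
rewrite -(sum_ext P f Us Uu su) -(sum_ext P g Ut Uu tu).
rewrite !scaler_sumr -!big_split hpart_sum // => n.
by apply: (grading_lin G); apply: homog_ext.
Qed.

HB.instance Definition _ P :=
  GRing.isLinear.Build k V V *:%R (hpart P) (hpart_linear P).

Lemma hpart_homog P n x : homog n x -> hpart P x = if P n then x else 0.
Proof.
move=> hx; pose f m := if m == n then x else 0.
have {1}-> : x = \sum_(m <- [:: n]) f m by rewrite big_seq1 /f eqxx.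
rewrite hpart_sum // => [|m]; last first.
  by rewrite /f; case: eqP => [->|] // _; apply: (grading0 G).
by rewrite big_cons !big_nil addr0 /f eqxx; case: (P n).
Qed.

Lemma homog_ind (Q : V -> Prop) : Q 0 -> (forall x y, Q x -> Q y -> Q (x + y)) ->
  (forall n x, homog n x -> Q x) -> forall x, Q x.
Proof.
move=> Q0 QD Qh x; have [s [f [hf ->]]] := grading_span G x.
by elim/big_ind: _ => // n _; apply: Qh.
Qed.

End Grading.

Section TensorMaps.
Variable k : fieldType.
Implicit Types A B C D W : lmodType k.

Lemma tlift_subproof A B W (f : A -> B -> W) (fP : bilinear_for *:%R *:%R f) :
  exists g : {linear (A \ox B)%type -> W}, forall a b, g (a \ox b) = f a b.
Proof.
pose F : {bilinear A -> B -> W} :=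
  HB.pack f (bilinear_isBilinear.Build k A B W *:%R *:%R f fP).
by have [g gE _] := tensor_universal F; exists g.
Qed.

Definition tlift A B W (f : A -> B -> W) (fP : bilinear_for *:%R *:%R f) :
  {linear (A \ox B)%type -> W} := sval (cid (tlift_subproof fP)).

Lemma tliftE A B W (f : A -> B -> W) (fP : bilinear_for *:%R *:%R f) a b :
  tlift fP (a \ox b) = f a b.
Proof. by rewrite /tlift; case: cid. Qed.

Section TensBilinear.
Variables (A B : lmodType k).

Lemma tensDl (a a' : A) (b : B) : (a + a') \ox b = a \ox b + a' \ox b.
Proof. exact: (linearDl (@tens k A B)). Qed.

Lemma tensDr (a : A) (b b' : B) : a \ox (b + b') = a \ox b + a \ox b'.
Proof. exact: (linearDr (@tens k A B)). Qed.

Lemma tensZl c (a : A) (b : B) : (c *: a) \ox b = c *: (a \ox b).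
Proof. exact: (linearZl_LR (@tens k A B)). Qed.

Lemma tensZr c (a : A) (b : B) : a \ox (c *: b) = c *: (a \ox b).
Proof. exact: (linearZr_LR (@tens k A B)). Qed.

Lemma tens0l (b : B) : (0 : A) \ox b = 0.
Proof. exact: (linear0l (@tens k A B)). Qed.

Lemma tens0r (a : A) : a \ox (0 : B) = 0.
Proof. exact: (linear0r (@tens k A B)). Qed.

HB.instance Definition _ (a : A) := GRing.isLinear.Build k B (A \ox B)%type
  *:%R (tens a) ((tens_is_bilinear A B).2 a).

Lemma tensor_ind (Q : (A \ox B)%type -> Prop) :
  Q 0 -> (forall x y, Q x -> Q y -> Q (x + y)) ->
  (forall a b, Q (a \ox b)) -> forall x, Q x.
Proof.
by move=> Q0 QD Qt x; have [s ->] := tensor_span x; elim/big_ind: _.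
Qed.

End TensBilinear.

Lemma tmap_bilinear A B C D (f : {linear A -> C}) (g : {linear B -> D}) :
  bilinear_for *:%R *:%R (fun a b => f a \ox g b).
Proof.
by split=> [b c x y|a c x y] /=; rewrite linearP ?(tensDl, tensZl, tensDr, tensZr).
Qed.

Definition tmap A B C D (f : {linear A -> C}) (g : {linear B -> D}) :
  {linear (A \ox B)%type -> (C \ox D)%type} := tlift (tmap_bilinear f g).

Lemma tmapE A B C D (f : {linear A -> C}) (g : {linear B -> D}) a b :
  tmap f g (a \ox b) = f a \ox g b.
Proof. exact: tliftE. Qed.

(** Linearity of [tmap] in its first map. The combination is a third linear map [f''] characterised
    pointwise, so that it can be instantiated with a map such as [u (c *: a + a')] which already has
    its own linear structure. *)
Lemma tmap_linl A B C D c (f f' f'' : {linear A -> C}) (g : {linear B -> D}) x :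
  (forall a, f'' a = c *: f a + f' a) ->
  tmap f'' g x = c *: tmap f g x + tmap f' g x.
Proof.
move=> fE; elim/tensor_ind: x => [|x y IHx IHy|a b].
- by rewrite !linear0 addr0.
- by rewrite !linearD IHx IHy addrACA.
by rewrite !tmapE fE tensDl tensZl.
Qed.

Lemma tmap_linr A B C D c (f : {linear A -> C}) (g g' g'' : {linear B -> D}) x :
  (forall b, g'' b = c *: g b + g' b) ->
  tmap f g'' x = c *: tmap f g x + tmap f g' x.
Proof.
move=> gE; elim/tensor_ind: x => [|x y IHx IHy|a b].
- by rewrite !linear0 addr0.
- by rewrite !linearD IHx IHy addrACA.
by rewrite !tmapE gE tensDr tensZr.
Qed.

End TensorMaps.

(** * Parity operators and the grading of the tensor product *)

Section Structure.
Variables (k : fieldType) (A : dgPoisson k).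

Lemma dgp_graded_algebra : is_graded_algebra (homog A) (dg_one A) (dg_mul A).
Proof. exact: dg_graded_algebra (dgp_dg_algebra (dgPoisson_axioms A)). Qed.

Lemma dgp_grading : is_grading (homog A).
Proof. exact: graded_grading dgp_graded_algebra. Qed.

Lemma dg_mulA : associative (dg_mul A).
Proof. exact: graded_mulA dgp_graded_algebra. Qed.

Lemma dg_mul1l : left_id (dg_one A) (dg_mul A).
Proof. exact: graded_mul1l dgp_graded_algebra. Qed.

Lemma dg_mul1r : right_id (dg_one A) (dg_mul A).
Proof. exact: graded_mul1r dgp_graded_algebra. Qed.

Lemma homog_one : homog A 0 (dg_one A).
Proof. exact: graded_homog1 dgp_graded_algebra. Qed.

Lemma homog_mul i j a b :
  homog A i a -> homog A j b -> homog A (i + j) (dg_mul A a b).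
Proof. exact: graded_homogM dgp_graded_algebra _ _ _ _. Qed.

Lemma homog_br i j a b :
  homog A i a -> homog A j b -> homog A (i + j) (dg_br A a b).
Proof. exact: dgp_homog_br (dgPoisson_axioms A) _ _ _ _. Qed.

Lemma homog_diff i a : homog A i a -> homog A (i + 1) (dg_diff A a).
Proof. exact: dg_homog_diff (dgp_dg_algebra (dgPoisson_axioms A)) _ _. Qed.

Lemma homog0 n : homog A n 0.
Proof. exact: grading0 dgp_grading n. Qed.

Lemma homogD n x y : homog A n x -> homog A n y -> homog A n (x + y).
Proof.
by move=> hx hy; rewrite -[x]scale1r; apply: (grading_lin dgp_grading).
Qed.

Lemma homogZ n c x : homog A n x -> homog A n (c *: x).
Proof.
move=> hx; rewrite -[_ *: x]addr0; apply: (grading_lin dgp_grading) => //.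
exact: homog0.
Qed.

HB.instance Definition _ := bilinear_isBilinear.Build k A A A *:%R *:%R
  (dg_mul A) (graded_mul_bilinear dgp_graded_algebra).

HB.instance Definition _ := bilinear_isBilinear.Build k A A A *:%R *:%R
  (dg_br A) (dgp_br_bilinear (dgPoisson_axioms A)).

HB.instance Definition _ (a : A) := GRing.isLinear.Build k A A *:%R
  (dg_mul A a) ((graded_mul_bilinear dgp_graded_algebra).2 a).

HB.instance Definition _ (a : A) := GRing.isLinear.Build k A A *:%R
  (dg_br A a) ((dgp_br_bilinear (dgPoisson_axioms A)).2 a).

HB.instance Definition _ := GRing.isLinear.Build k A A *:%R
  (dg_diff A) (dg_diff_linear (dgp_dg_algebra (dgPoisson_axioms A))).

Definition parity_part (e : bool) : A -> A :=
  hpart dgp_grading (fun n => oddz n == e).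

HB.instance Definition _ e := GRing.isLinear.Build k A A *:%R
  (parity_part e) (hpart_linear dgp_grading _).

Lemma parity_part_homog e n a :
  homog A n a -> parity_part e a = if oddz n == e then a else 0.
Proof. exact: hpart_homog. Qed.

(* The lock keeps rewriting with linearity from unfolding the difference. *)
Definition sign_twist (a : A) : A :=
  locked (parity_part false a - parity_part true a).

Fact sign_twist_linear : linear sign_twist.
Proof.
move=> c x y; rewrite /sign_twist -!lock ![parity_part _ _]linearP.
by rewrite opprD addrACA scalerBr.
Qed.
HB.instance Definition _ := GRing.isLinear.Build k A A *:%R
  sign_twist sign_twist_linear.

Lemma sign_twistE n a : homog A n a -> sign_twist a = (-1) ^ n *: a.
Proof.
move=> ha; rewrite /sign_twist -lock !(parity_part_homog _ ha) signz_oddz.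
by case: (oddz n); rewrite /= ?sub0r ?subr0 ?expr1 ?expr0 ?scaleN1r ?scale1r.
Qed.

End Structure.

Section Homog.
Variables (k : fieldType) (A B : dgPoisson k).
Implicit Types x y : (A \ox B)%type.

Lemma tensor_homog_tens i j (a : A) (b : B) :
  homog A i a -> homog B j b -> tensor_homog (i + j) (a \ox b).
Proof.
move=> ha hb; exists [:: (a, b)]; split; last by rewrite big_seq1.
by move=> p; rewrite inE => /eqP ->; exists i, j.
Qed.

Lemma tensor_homog0 n : tensor_homog n (0 : (A \ox B)%type).
Proof. by exists [::]; rewrite big_nil. Qed.

Lemma tensor_homog_lin n c x y :
  tensor_homog n x -> tensor_homog n y -> tensor_homog n (c *: x + y).
Proof.
case=> s [sh ->] [t [th ->]]; exists ([seq (c *: p.1, p.2) | p <- s] ++ t).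
split=> [p|]; last first.
  rewrite big_cat big_map scaler_sumr; congr (_ + _).
  by apply: eq_bigr => p _; rewrite tensZl.
rewrite mem_cat => /orP[/mapP[q qs ->]|]; last exact: th.
by have [i [j [ij qi qj]]] := sh q qs; exists i, j; split=> //; apply: homogZ.
Qed.

Lemma tensor_homog_ind n (Q : (A \ox B)%type -> Prop) :
  Q 0 -> (forall x y, Q x -> Q y -> Q (x + y)) ->
  (forall i j a b, homog A i a -> homog B j b -> i + j = n -> Q (a \ox b)) ->
  forall x, tensor_homog n x -> Q x.
Proof.
move=> Q0 QD Qt x [s [sh ->]]; rewrite big_seq; elim/big_ind: _ => // p ps.
by have [i [j [ij pi pj]]] := sh p ps; apply: Qt ij.
Qed.

(** Additive closure suffices because a scalar can be absorbed into a factor without changing its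
    degree. *)
Lemma tensor_pure_ind (Q : (A \ox B)%type -> Prop) :
  Q 0 -> (forall x y, Q x -> Q y -> Q (x + y)) ->
  (forall i j a b, homog A i a -> homog B j b -> Q (a \ox b)) ->
  forall x, Q x.
Proof.
move=> Q0 QD Qt; apply: tensor_ind => // a b.
elim/(homog_ind (dgp_grading A)): a => [|a a' Qa Qa'|i a ha].
- by rewrite tens0l.
- by rewrite tensDl; apply: QD.
elim/(homog_ind (dgp_grading B)): b => [|b b' Qb Qb'|j b hb].
- by rewrite tens0r.
- by rewrite tensDr; apply: QD.
exact: Qt ha hb.
Qed.

Lemma tensor_homog_span x : exists (s : seq int) (f : int -> (A \ox B)%type),
  (forall n, tensor_homog n (f n)) /\ x = \sum_(n <- s) f n.
Proof.
have [l lh ->] : exists2 l : seq (int * (A \ox B)%type),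
    (forall q, q \in l -> tensor_homog q.1 q.2) & x = \sum_(q <- l) q.2.
  elim/tensor_pure_ind: x => [|x y [l lh ->] [m mh ->]|i j a b ha hb].
  - by exists [::]; rewrite // big_nil.
  - exists (l ++ m); last by rewrite big_cat.
    by move=> q; rewrite mem_cat => /orP[/lh|/mh].
  - exists [:: (i + j, a \ox b)]; last by rewrite big_seq1.
    by move=> q; rewrite inE => /eqP ->; apply: tensor_homog_tens.
(* The homogeneous terms are grouped by degree. After the two sums are exchanged, each term is
   counted for exactly one index, its own degree, because the list of degrees has no repetition. *)
exists (undup (map fst l)), (fun n => \sum_(q <- l | q.1 == n) q.2).
split=> [n|].
  rewrite big_seq_cond; elim/big_ind: _ => [|y z hy hz|q].
  - exact: tensor_homog0.
  - by rewrite -[y]scale1r; apply: tensor_homog_lin.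
  - by case/andP=> /lh hq /eqP <-.
rewrite (exchange_big_dep xpredT) //= big_seq [RHS]big_seq.
apply: eq_bigr => q ql.
rewrite -big_filter (_ : filter _ _ = [:: q.1]) ?big_seq1 //.
have qu : q.1 \in undup (map fst l) by rewrite mem_undup map_f.
rewrite -(@eq_filter _ (pred1 q.1)) => [|n]; last exact: eq_sym.
by rewrite filter_pred1_uniq // undup_uniq.
Qed.

(* Projecting to degree i on A and n - i on B, for the finitely many i that
   occur in f n, fixes f n and kills the other f m. *)
Lemma tensor_homog_free (s : seq int) (f : int -> (A \ox B)%type) : uniq s ->
  (forall n, tensor_homog n (f n)) -> \sum_(n <- s) f n = 0 ->
  forall n, n \in s -> f n = 0.
Proof.
move=> Us hf sum0 n ns; have [t [th ft]] := hf n.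
(* A term of [f n] may admit several degrees in A, a zero factor having all of them, so one is
   chosen for each term. The value 0 outside [t] is a mere default. *)
have /choice[d dP] p : exists i, p \in t -> homog A i p.1 /\ homog B (n - i) p.2.
  have [/th[i [j [<- pi pj]]]|_] := boolP (p \in t); last by exists 0.
  by exists i => _; rewrite addrC addKr.
pose D := undup (map d t).
pose p (C : dgPoisson k) i : {linear C -> C} := hpart (dgp_grading C) (pred1 i).
pose P x := \sum_(i <- D) tmap (p A i) (p B (n - i)) x.
have P0 : P 0 = 0 by rewrite /P big1 // => i _; rewrite linear0.
have PD : {morph P : x y / x + y}.
  by move=> x y; rewrite /P -big_split; apply: eq_bigr => i _; rewrite linearD.
have PE i j a b : homog A i a -> homog B j b ->
    P (a \ox b) = if (i \in D) && (i + j == n) then a \ox b else 0.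
  move=> ha hb; rewrite /P; case: ifP => [/andP[iD /eqP ijn]|ijD].
    rewrite (bigD1_seq i) ?undup_uniq //= big1 => [|l /negPf li]; last first.
      by rewrite tmapE /p /= (hpart_homog _ _ ha) /= eq_sym li tens0l.
    rewrite tmapE /p /= (hpart_homog _ _ ha) (hpart_homog _ _ hb) /= eqxx.
    by rewrite -ijn (addrC i) addrK eqxx addr0.
  rewrite big_seq big1 // => l lD; rewrite tmapE /p /= (hpart_homog _ _ ha).
  rewrite (hpart_homog _ _ hb) /=; case: eqP => [il|_]; last by rewrite tens0l.
  case: eqP => [jl|_]; last by rewrite tens0r.
  by move: ijD; rewrite il lD jl addrC subrK eqxx.
have fn : P (f n) = f n.
  rewrite ft (big_morph P PD P0) big_seq [RHS]big_seq; apply: eq_bigr => q qt.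
  have [hq1 hq2] := dP _ qt; rewrite (PE _ _ _ _ hq1 hq2) mem_undup map_f //.
  by rewrite addrC subrK eqxx.
have fm m : m != n -> P (f m) = 0.
  move=> /negPf mn; elim/tensor_homog_ind: (hf m) => // [x y Px Py|i j a b ha hb ij].
    by rewrite PD Px Py addr0.
  by rewrite (PE _ _ _ _ ha hb) ij mn andbF.
have := congr1 P sum0; rewrite P0 (big_morph P PD P0) (bigD1_seq n) //= fn.
by rewrite big1 ?addr0.
Qed.

Lemma tensor_grading : is_grading (@tensor_homog k A B).
Proof.
split; [exact: tensor_homog0 | exact: tensor_homog_lin | exact: tensor_homog_span
       | exact: tensor_homog_free].
Qed.

End Homog.

(** * Bilinear operations on a tensor product with the Koszul sign *)

Section Box.
Variables (k : fieldType) (A B : dgPoisson k).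
Implicit Types (u : {bilinear A -> A -> A}) (v : {bilinear B -> B -> B}).

(* The sign (-1)^(|a'||b|) is trivial on the even part of b, and twists a' by
   (-1)^|a'| on its odd part. *)
Definition box_curry u v (y : (A \ox B)%type) (a : A) (b : B) : (A \ox B)%type :=
  tmap (u a) (v (parity_part false b)) y
  + tmap (u a \o @sign_twist k A) (v (parity_part true b)) y.

Lemma box_curry_bilinear u v y :
  bilinear_for *:%R *:%R (box_curry u v y).
Proof.
rewrite /box_curry; split=> [b c a a'|a c b b'] /=.
  rewrite (tmap_linl (c := c) (f := u a) (f' := u a') (f'' := u (c *: a + a'))).
    rewrite (tmap_linl (c := c) (f := u a \o @sign_twist k A)
      (f' := u a' \o @sign_twist k A) (f'' := u (c *: a + a') \o @sign_twist k A)).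
      by rewrite scalerDr addrACA.
    by move=> z; rewrite /= (linearPl u).
  by move=> z; rewrite /= (linearPl u).
have vP e z : v (parity_part e (c *: b + b')) z
    = c *: v (parity_part e b) z + v (parity_part e b') z.
  by rewrite [parity_part _ _]linearP (linearPl v).
by rewrite !(tmap_linr _ _ (vP _)) scalerDr addrACA.
Qed.

Definition box u v (x y : (A \ox B)%type) : (A \ox B)%type :=
  tlift (box_curry_bilinear u v y) x.

Lemma box_bilinear u v : bilinear_for *:%R *:%R (box u v).
Proof.
split=> [y c x x'|x c y y'] /=; first by rewrite /box linearP.
elim/tensor_ind: x => [|x x' IH IH'|a b].
- by rewrite /box !linear0 addr0.
- by rewrite /box !linearD -!/(box _ _ _ _) IH IH' addrACA.
by rewrite /box !tliftE /box_curry !linearP scalerDr addrACA.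
Qed.
HB.instance Definition _ u v := bilinear_isBilinear.Build k
  (A \ox B)%type (A \ox B)%type (A \ox B)%type *:%R *:%R (box u v) (box_bilinear u v).

(** Only the inner factors a' and b cross each other, so only their degrees are required. For odd b
    the surviving summand is the twisted one, for even b the other. *)
Lemma boxE u v i' j a b a' b' : homog A i' a' -> homog B j b ->
  box u v (a \ox b) (a' \ox b') = (-1) ^ (i' * j) *: (u a a' \ox v b b').
Proof.
move=> ha' hb; rewrite /box tliftE /box_curry !tmapE /= (sign_twistE ha').
rewrite !(parity_part_homog _ hb) !signzE linearZ tensZl.
case: (oddz j); rewrite /= (linear0l v) tens0r ?scaler0 ?add0r ?addr0 ?andbT //.
by rewrite andbF expr0 scale1r.
Qed.

End Box.

(** * The DG Poisson structure of the tensor product *)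

(** Signs become powers of -1 with boolean exponents; products of signs fold into exclusive or and
    opposites into negation. Once every parity is fixed, both sides compute to the same power. *)
Ltac signz := rewrite ?signzE -?(signr_addb, signrN);
  repeat match goal with |- context [oddz ?m] => case: (oddz m) end;
  reflexivity.

Section PoissonLaws.
Variables (k : fieldType) (A : dgPoisson k).

Lemma dg_mulC i j (a b : A) : homog A i a -> homog A j b ->
  dg_mul A a b = (-1) ^ (i * j) *: dg_mul A b a.
Proof. exact: dgp_mulC (dgPoisson_axioms A) _ _ _ _. Qed.

Lemma dg_mulCA i j (a b c : A) : homog A i a -> homog A j b ->
  dg_mul A a (dg_mul A b c) = (-1) ^ (i * j) *: dg_mul A b (dg_mul A a c).
Proof.
by move=> ha hb; rewrite !dg_mulA (dg_mulC ha hb) (linearZl_LR (dg_mul A)).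
Qed.

Lemma dg_br_anti i j (a b : A) : homog A i a -> homog A j b ->
  dg_br A a b = - ((-1) ^ (i * j) *: dg_br A b a).
Proof. exact: dgp_br_anti (dgPoisson_axioms A) _ _ _ _. Qed.

Lemma dg_jacobi i j l (a b c : A) : homog A i a -> homog A j b -> homog A l c ->
  dg_br A a (dg_br A b c)
  = dg_br A (dg_br A a b) c + (-1) ^ (i * j) *: dg_br A b (dg_br A a c).
Proof. exact: dgp_jacobi (dgPoisson_axioms A) _ _ _ _ _ _. Qed.

Lemma dg_leibniz i j l (a b c : A) : homog A i a -> homog A j b -> homog A l c ->
  dg_br A a (dg_mul A b c)
  = dg_mul A (dg_br A a b) c + (-1) ^ (i * j) *: dg_mul A b (dg_br A a c).
Proof. exact: dgp_leibniz (dgPoisson_axioms A) _ _ _ _ _ _. Qed.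

Lemma dg_diff_br i j (a b : A) : homog A i a -> homog A j b ->
  dg_diff A (dg_br A a b)
  = dg_br A (dg_diff A a) b + (-1) ^ i *: dg_br A a (dg_diff A b).
Proof. exact: dgp_diff_br (dgPoisson_axioms A) _ _ _ _. Qed.

Lemma dg_diff_mul i j (a b : A) : homog A i a -> homog A j b ->
  dg_diff A (dg_mul A a b)
  = dg_mul A (dg_diff A a) b + (-1) ^ i *: dg_mul A a (dg_diff A b).
Proof. exact: dg_diffM (dgp_dg_algebra (dgPoisson_axioms A)) _ _ _ _. Qed.

Lemma dg_diff_diff (a : A) : dg_diff A (dg_diff A a) = 0.
Proof. exact: dg_diff2 (dgp_dg_algebra (dgPoisson_axioms A)) _. Qed.

Lemma dg_brZl c (a b : A) : dg_br A (c *: a) b = c *: dg_br A a b.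
Proof. exact: (linearZl_LR (dg_br A)). Qed.

Lemma dg_brZr c (a b : A) : dg_br A a (c *: b) = c *: dg_br A a b.
Proof. exact: (linearZr_LR (dg_br A)). Qed.

Lemma dg_mulZl c (a b : A) : dg_mul A (c *: a) b = c *: dg_mul A a b.
Proof. exact: (linearZl_LR (dg_mul A)). Qed.

Lemma dg_mulZr c (a b : A) : dg_mul A a (c *: b) = c *: dg_mul A a b.
Proof. exact: (linearZr_LR (dg_mul A)). Qed.

Lemma dg_diffZ c (a : A) : dg_diff A (c *: a) = c *: dg_diff A a.
Proof. exact: linearZ. Qed.

(** The Leibniz rule in the first argument, obtained from the one in the second by antisymmetry;
    commutativity then moves b in front of {a,c}. The Jacobi identity needs it, since there the left
    argument of a bracket is itself a product. *)
Lemma dg_leibnizl i j l (a b c : A) : homog A i a -> homog A j b -> homog A l c ->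
  dg_br A (dg_mul A a b) c
  = dg_mul A a (dg_br A b c) + (-1) ^ (i * j) *: dg_mul A b (dg_br A a c).
Proof.
move=> ha hb hc; rewrite (dg_br_anti (homog_mul ha hb) hc) -scaleNr.
rewrite (dg_leibniz hc ha hb) (dg_br_anti hc ha) (dg_br_anti hc hb).
rewrite -!scaleNr !(dg_mulZl, dg_mulZr).
rewrite (dg_mulC (homog_br ha hc) hb).
rewrite scalerDr !scalerA [LHS]addrC -[X in _ = X + _]scale1r.
congr (_ *: _ + _ *: _); signz.
Qed.

End PoissonLaws.

Section TensorOps.
Variables (k : fieldType) (A B : dgPoisson k).
Implicit Types x y z : (A \ox B)%type.

Definition tensor_one : (A \ox B)%type := dg_one A \ox dg_one B.

Definition tensor_mul x y : (A \ox B)%type := box (dg_mul A) (dg_mul B) x y.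

(** Both summands of the bracket carry the same sign, so each is an instance of [box]. *)
Definition tensor_br x y : (A \ox B)%type :=
  locked (box (dg_br A) (dg_mul B) x y + box (dg_mul A) (dg_br B) x y).

Definition tensor_diff x : (A \ox B)%type :=
  locked (tmap (dg_diff A) idfun x + tmap (@sign_twist k A) (dg_diff B) x).

Lemma tensor_mul_bilinear : bilinear_for *:%R *:%R tensor_mul.
Proof. exact: box_bilinear. Qed.

Lemma tensor_br_bilinear : bilinear_for *:%R *:%R tensor_br.
Proof.
split=> [y c x x'|x c y y'] /=; rewrite /tensor_br -!lock.
  by rewrite !linearPl scalerDr addrACA.
by rewrite !linearPr scalerDr addrACA.
Qed.

Lemma tensor_diff_linear : linear tensor_diff.
Proof.
move=> c x y; rewrite /tensor_diff -!lock (linearP (tmap (dg_diff A) idfun)).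
by rewrite (linearP (tmap (@sign_twist k A) (dg_diff B))) scalerDr addrACA.
Qed.

HB.instance Definition _ := bilinear_isBilinear.Build k
  (A \ox B)%type (A \ox B)%type (A \ox B)%type *:%R *:%R
  tensor_mul tensor_mul_bilinear.
HB.instance Definition _ := bilinear_isBilinear.Build k
  (A \ox B)%type (A \ox B)%type (A \ox B)%type *:%R *:%R
  tensor_br tensor_br_bilinear.
HB.instance Definition _ := GRing.isLinear.Build k
  (A \ox B)%type (A \ox B)%type *:%R tensor_diff tensor_diff_linear.

Lemma tensor_mulE i' j a b a' b' : homog A i' a' -> homog B j b ->
  tensor_mul (a \ox b) (a' \ox b')
  = (-1) ^ (i' * j) *: (dg_mul A a a' \ox dg_mul B b b').
Proof. exact: boxE. Qed.

Lemma tensor_brE i' j a b a' b' : homog A i' a' -> homog B j b ->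
  tensor_br (a \ox b) (a' \ox b')
  = (-1) ^ (i' * j) *: (dg_br A a a' \ox dg_mul B b b'
                        + dg_mul A a a' \ox dg_br B b b').
Proof. by move=> ha hb; rewrite /tensor_br -lock !(boxE _ _ _ _ ha hb) scalerDr. Qed.

Lemma tensor_diffE i a b : homog A i a ->
  tensor_diff (a \ox b) = dg_diff A a \ox b + (-1) ^ i *: (a \ox dg_diff B b).
Proof.
by move=> ha; rewrite /tensor_diff -lock !tmapE /= (sign_twistE ha) tensZl.
Qed.

Lemma tensor_homogD n x y :
  tensor_homog n x -> tensor_homog n y -> tensor_homog n (x + y).
Proof. by move=> hx hy; rewrite -[x]scale1r; apply: tensor_homog_lin. Qed.

Lemma tensor_homogZ n c x : tensor_homog n x -> tensor_homog n (c *: x).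
Proof.
by move=> hx; rewrite -[_ *: x]addr0; apply/tensor_homog_lin/tensor_homog0.
Qed.

Let tmul0l : forall y, tensor_mul 0 y = 0.
Proof. exact: (linear0l tensor_mul). Qed.

Let tmul0r : forall x, tensor_mul x 0 = 0.
Proof. exact: (linear0r tensor_mul). Qed.

Let tmulDl : forall x y z, tensor_mul (x + y) z = tensor_mul x z + tensor_mul y z.
Proof. exact: (fun x y z => linearDl tensor_mul z x y). Qed.

Let tmulDr : forall x y z, tensor_mul x (y + z) = tensor_mul x y + tensor_mul x z.
Proof. exact: (linearDr tensor_mul). Qed.

Let tmulZl : forall c x y, tensor_mul (c *: x) y = c *: tensor_mul x y.
Proof. exact: (fun c x y => linearZl_LR tensor_mul y c x). Qed.

Let tmulZr : forall c x y, tensor_mul x (c *: y) = c *: tensor_mul x y.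
Proof. exact: (fun c x y => linearZr_LR tensor_mul x c y). Qed.

Let tbr0l : forall y, tensor_br 0 y = 0.
Proof. exact: (linear0l tensor_br). Qed.

Let tbr0r : forall x, tensor_br x 0 = 0.
Proof. exact: (linear0r tensor_br). Qed.

Let tbrDl : forall x y z, tensor_br (x + y) z = tensor_br x z + tensor_br y z.
Proof. exact: (fun x y z => linearDl tensor_br z x y). Qed.

Let tbrDr : forall x y z, tensor_br x (y + z) = tensor_br x y + tensor_br x z.
Proof. exact: (linearDr tensor_br). Qed.

Let tbrZl : forall c x y, tensor_br (c *: x) y = c *: tensor_br x y.
Proof. exact: (fun c x y => linearZl_LR tensor_br y c x). Qed.

Let tbrZr : forall c x y, tensor_br x (c *: y) = c *: tensor_br x y.
Proof. exact: (fun c x y => linearZr_LR tensor_br x c y). Qed.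

Let tdiff0 : tensor_diff 0 = 0.
Proof. exact: linear0. Qed.

Let tdiffD : forall x y, tensor_diff (x + y) = tensor_diff x + tensor_diff y.
Proof. exact: linearD. Qed.

Let tdiffZ : forall c x, tensor_diff (c *: x) = c *: tensor_diff x.
Proof. exact: linearZ_LR. Qed.

(** In the inductions below, [zeroE] settles the zero case and [addE] splits the sum case; [scaleE]
    pulls the signs out in the case of pure tensors. *)
Let zeroE := (tmul0l, tmul0r, tbr0l, tbr0r, tdiff0, scaler0, oppr0, addr0).
Let addE := (tmulDl, tmulDr, tbrDl, tbrDr, tdiffD, scalerDr, opprD).
Let scaleE := (tmulZl, tmulZr, tbrZl, tbrZr, tdiffZ).

Lemma tensor_homog_mul i j x y : tensor_homog i x -> tensor_homog j y ->
  tensor_homog (i + j) (tensor_mul x y).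
Proof.
move=> hx hy; elim/tensor_homog_ind: hx => [|x1 x2 H1 H2|p q a b ha hb <-].
- by rewrite zeroE; apply: tensor_homog0.
- by rewrite addE; apply: tensor_homogD.
elim/tensor_homog_ind: hy => [|x1 x2 H1 H2|p' q' a' b' ha' hb' <-].
- by rewrite zeroE; apply: tensor_homog0.
- by rewrite addE; apply: tensor_homogD.
rewrite (tensor_mulE _ _ ha' hb) addrACA; apply: tensor_homogZ.
by apply: tensor_homog_tens; apply: homog_mul.
Qed.

Lemma tensor_homog_br i j x y : tensor_homog i x -> tensor_homog j y ->
  tensor_homog (i + j) (tensor_br x y).
Proof.
move=> hx hy; elim/tensor_homog_ind: hx => [|x1 x2 H1 H2|p q a b ha hb <-].
- by rewrite zeroE; apply: tensor_homog0.
- by rewrite addE; apply: tensor_homogD.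
elim/tensor_homog_ind: hy => [|x1 x2 H1 H2|p' q' a' b' ha' hb' <-].
- by rewrite zeroE; apply: tensor_homog0.
- by rewrite addE; apply: tensor_homogD.
rewrite (tensor_brE _ _ ha' hb) addrACA; apply/tensor_homogZ/tensor_homogD.
  by apply: tensor_homog_tens; [apply: homog_br | apply: homog_mul].
by apply: tensor_homog_tens; [apply: homog_mul | apply: homog_br].
Qed.

Lemma tensor_homog_diff i x : tensor_homog i x ->
  tensor_homog (i + 1) (tensor_diff x).
Proof.
elim/tensor_homog_ind=> [|x1 x2 H1 H2|p q a b ha hb <-].
- by rewrite zeroE; apply: tensor_homog0.
- by rewrite addE; apply: tensor_homogD.
rewrite (tensor_diffE _ ha); apply/tensor_homogD/tensor_homogZ.
  by rewrite addrAC; apply: tensor_homog_tens => //; apply: homog_diff.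
by rewrite -addrA; apply: tensor_homog_tens => //; apply: homog_diff.
Qed.

Lemma tensor_mulA : associative tensor_mul.
Proof.
elim/tensor_pure_ind=> [y z|x1 x2 H1 H2 y z|i j a b ha hb].
- by rewrite !zeroE.
- by rewrite !addE H1 H2.
elim/tensor_pure_ind=> [z|x1 x2 H1 H2 z|i' j' a' b' ha' hb'].
- by rewrite !zeroE.
- by rewrite !addE H1 H2.
elim/tensor_pure_ind=> [|x1 x2 H1 H2|i2 j2 a2 b2 ha2 hb2].
- by rewrite !zeroE.
- by rewrite !addE H1 H2.
rewrite (tensor_mulE _ _ ha2 hb') (tensor_mulE _ _ ha' hb) !scaleE.
rewrite (tensor_mulE _ _ (homog_mul ha' ha2) hb).
rewrite (tensor_mulE _ _ ha2 (homog_mul hb hb')) !scalerA !dg_mulA.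
(* With i2 the degree of a2, both exponents equal i'j + i2 j + i2 j'. *)
congr (_ *: _); signz.
Qed.

Lemma tensor_mul1l : left_id tensor_one tensor_mul.
Proof.
elim/tensor_pure_ind=> [|x1 x2 H1 H2|i j a b ha hb].
- by rewrite !zeroE.
- by rewrite !addE H1 H2.
rewrite (tensor_mulE _ _ ha (homog_one B)) !dg_mul1l mulr0 expr0z.
exact: scale1r.
Qed.

Lemma tensor_mul1r : right_id tensor_one tensor_mul.
Proof.
elim/tensor_pure_ind=> [|x1 x2 H1 H2|i j a b ha hb].
- by rewrite !zeroE.
- by rewrite !addE H1 H2.
rewrite (tensor_mulE _ _ (homog_one A) hb) !dg_mul1r mul0r expr0z.
exact: scale1r.
Qed.

Lemma tensor_mulC i j x y : tensor_homog i x -> tensor_homog j y ->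
  tensor_mul x y = (-1) ^ (i * j) *: tensor_mul y x.
Proof.
move=> hx hy; elim/tensor_homog_ind: hx => [|x1 x2 H1 H2|p q a b ha hb <-].
- by rewrite !zeroE.
- by rewrite !addE H1 H2.
elim/tensor_homog_ind: hy => [|x1 x2 H1 H2|p' q' a' b' ha' hb' <-].
- by rewrite !zeroE.
- by rewrite !addE H1 H2.
rewrite (tensor_mulE _ _ ha' hb) (tensor_mulE _ _ ha hb').
rewrite (dg_mulC ha ha') (dg_mulC hb hb') tensZl tensZr !scalerA.
(* Modulo 2, p'q + pp' + qq' agrees with (p+q)(p'+q') + pq'. *)
congr (_ *: _); signz.
Qed.

(** Each summand is a bracket in one factor and a product in the other: antisymmetry gives exactly
    one minus sign, and the remaining signs are those of commutativity. *)
Lemma tensor_br_anti i j x y : tensor_homog i x -> tensor_homog j y ->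
  tensor_br x y = - ((-1) ^ (i * j) *: tensor_br y x).
Proof.
move=> hx hy; elim/tensor_homog_ind: hx => [|x1 x2 H1 H2|p q a b ha hb <-].
- by rewrite !zeroE.
- by rewrite !addE H1 H2.
elim/tensor_homog_ind: hy => [|x1 x2 H1 H2|p' q' a' b' ha' hb' <-].
- by rewrite !zeroE.
- by rewrite !addE H1 H2.
rewrite (tensor_brE _ _ ha' hb) (tensor_brE _ _ ha hb').
rewrite (dg_mulC ha ha') (dg_mulC hb hb') (dg_br_anti ha ha') (dg_br_anti hb hb').
rewrite -!scaleNr !(tensZl, tensZr).
rewrite !scalerDr !scalerA.
congr (_ *: _ + _ *: _); signz.
Qed.

Lemma tensor_diff_mul i j x y : tensor_homog i x -> tensor_homog j y ->
  tensor_diff (tensor_mul x y)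
  = tensor_mul (tensor_diff x) y + (-1) ^ i *: tensor_mul x (tensor_diff y).
Proof.
move=> hx hy; elim/tensor_homog_ind: hx => [|x1 x2 H1 H2|p q a b ha hb <-].
- by rewrite !zeroE.
- by rewrite !addE H1 H2 addrACA.
elim/tensor_homog_ind: hy => [|x1 x2 H1 H2|p' q' a' b' ha' hb' _].
- by rewrite !zeroE.
- by rewrite !addE H1 H2 addrACA.
rewrite (tensor_diffE _ ha) (tensor_diffE _ ha') (tensor_mulE _ _ ha' hb).
rewrite !addE !scaleE (tensor_diffE _ (homog_mul ha ha')).
rewrite (tensor_mulE _ _ ha' hb) (tensor_mulE _ _ ha' (homog_diff hb)).
rewrite (tensor_mulE _ _ (homog_diff ha') hb) (tensor_mulE _ _ ha' hb).
rewrite (dg_diff_mul ha ha') (dg_diff_mul hb hb').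
rewrite !(tensDl, tensDr, tensZl, tensZr) !scalerDr !scalerA.
(* The left side groups its four terms by the factor on which the differential acts, the right side
   by the argument x or y; exchanging the two middle terms aligns them. *)
rewrite [LHS]addrACA; congr (_ *: _ + _ *: _ + (_ *: _ + _ *: _)); signz.
Qed.

(** Apart from the squares of the two differentials, da (x) db arises twice, with the opposite signs
    (-1)^i and (-1)^(i+1). *)
Lemma tensor_diff_diff x : tensor_diff (tensor_diff x) = 0.
Proof.
elim/tensor_pure_ind: x => [|x1 x2 H1 H2|i j a b ha hb].
- by rewrite !zeroE.
- by rewrite !addE H1 H2 addr0.
rewrite (tensor_diffE _ ha) tdiffD tdiffZ (tensor_diffE _ ha).
rewrite (tensor_diffE _ (homog_diff ha)) !dg_diff_diff tens0l tens0r scaler0 addr0.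
rewrite add0r -scalerDl !signzE; case: (oddz i); rewrite /= ?(addNr, subrr);
  by rewrite scale0r.
Qed.

Lemma tensor_leibniz i j l x y z :
  tensor_homog i x -> tensor_homog j y -> tensor_homog l z ->
  tensor_br x (tensor_mul y z)
  = tensor_mul (tensor_br x y) z + (-1) ^ (i * j) *: tensor_mul y (tensor_br x z).
Proof.
move=> hx hy hz; elim/tensor_homog_ind: hx => [|x1 x2 H1 H2|p q a b ha hb <-].
- by rewrite !zeroE.
- by rewrite !addE H1 H2 addrACA.
elim/tensor_homog_ind: hy => [|x1 x2 H1 H2|p' q' a' b' ha' hb' <-].
- by rewrite !zeroE.
- by rewrite !addE H1 H2 addrACA.
elim/tensor_homog_ind: hz => [|x1 x2 H1 H2|p2 q2 a2 b2 ha2 hb2 _].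
- by rewrite !zeroE.
- by rewrite !addE H1 H2 addrACA.
rewrite (tensor_mulE _ _ ha2 hb') (tensor_brE _ _ ha' hb) (tensor_brE _ _ ha2 hb).
rewrite !scaleE !addE ?scaleE (tensor_brE _ _ (homog_mul ha' ha2) hb).
rewrite (tensor_mulE _ _ ha2 (homog_mul hb hb')).
rewrite (tensor_mulE _ _ ha2 (homog_br hb hb')).
rewrite (tensor_mulE _ _ (homog_br ha ha2) hb').
rewrite (tensor_mulE _ _ (homog_mul ha ha2) hb').
rewrite (dg_leibniz ha ha' ha2) (dg_leibniz hb hb' hb2) -!dg_mulA.
(* The terms of y {x,z} contain b'(b b2) and a'(a a2); these are brought to the order produced by
   {x, yz}. *)
rewrite (dg_mulCA _ hb' hb) (dg_mulCA _ ha' ha).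
rewrite !(tensDl, tensDr, tensZl, tensZr) !scalerDr !scalerA.
rewrite [LHS]addrACA; congr (_ *: _ + _ *: _ + (_ *: _ + _ *: _)); signz.
Qed.

Lemma tensor_diff_br i j x y : tensor_homog i x -> tensor_homog j y ->
  tensor_diff (tensor_br x y)
  = tensor_br (tensor_diff x) y + (-1) ^ i *: tensor_br x (tensor_diff y).
Proof.
move=> hx hy; elim/tensor_homog_ind: hx => [|x1 x2 H1 H2|p q a b ha hb <-].
- by rewrite !zeroE.
- by rewrite !addE H1 H2 addrACA.
elim/tensor_homog_ind: hy => [|x1 x2 H1 H2|p' q' a' b' ha' hb' _].
- by rewrite !zeroE.
- by rewrite !addE H1 H2 addrACA.
rewrite (tensor_diffE _ ha) (tensor_diffE _ ha') (tensor_brE _ _ ha' hb).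
rewrite !addE !scaleE (tensor_diffE _ (homog_br ha ha')).
rewrite (tensor_diffE _ (homog_mul ha ha')).
rewrite (tensor_brE _ _ ha' hb) (tensor_brE _ _ ha' (homog_diff hb)).
rewrite (tensor_brE _ _ (homog_diff ha') hb) (tensor_brE _ _ ha' hb).
rewrite (dg_diff_mul ha ha') (dg_diff_mul hb hb').
rewrite (dg_diff_br ha ha') (dg_diff_br hb hb').
rewrite !(tensDl, tensDr, tensZl, tensZr) !scalerDr !scalerA.
(* Among the eight terms on the left, those numbered 1, 5, 3, 7 differentiate x and match {dx, y};
   those numbered 2, 6, 4, 8 differentiate y and match {x, dy}. *)
rewrite [LHS](AC ((2*2)*(2*2)) (1*5*(3*7)*(2*6*(4*8)))) /=.
by congr (_ *: _ + _ *: _ + (_ *: _ + _ *: _)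
  + (_ *: _ + _ *: _ + (_ *: _ + _ *: _))); signz.
Qed.

(** Terms with a double bracket in one factor are governed by the Jacobi identity of that factor,
    and terms with one bracket in each factor by the Leibniz rules. This gives eight terms on the
    left and twelve on the right, of which four cancel. *)
Lemma tensor_jacobi i j l x y z :
  tensor_homog i x -> tensor_homog j y -> tensor_homog l z ->
  tensor_br x (tensor_br y z)
  = tensor_br (tensor_br x y) z + (-1) ^ (i * j) *: tensor_br y (tensor_br x z).
Proof.
move=> hx hy hz; elim/tensor_homog_ind: hx => [|x1 x2 H1 H2|p q a b ha hb <-].
- by rewrite !zeroE.
- by rewrite !addE H1 H2 addrACA.
elim/tensor_homog_ind: hy => [|x1 x2 H1 H2|p' q' a' b' ha' hb' <-].
- by rewrite !zeroE.
- by rewrite !addE H1 H2 addrACA.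
elim/tensor_homog_ind: hz => [|x1 x2 H1 H2|p2 q2 a2 b2 ha2 hb2 _].
- by rewrite !zeroE.
- by rewrite !addE H1 H2 addrACA.
rewrite (tensor_brE _ _ ha2 hb') (tensor_brE _ _ ha' hb) (tensor_brE _ _ ha2 hb).
rewrite !scaleE !addE ?scaleE.
rewrite (tensor_brE _ _ (homog_mul ha' ha2) hb) (tensor_brE _ _ (homog_br ha' ha2) hb).
rewrite (tensor_brE _ _ ha2 (homog_mul hb hb')) (tensor_brE _ _ ha2 (homog_br hb hb')).
rewrite (tensor_brE _ _ (homog_br ha ha2) hb') (tensor_brE _ _ (homog_mul ha ha2) hb').
rewrite (dg_leibniz ha ha' ha2) (dg_leibniz hb hb' hb2).
rewrite (dg_leibniz ha' ha ha2) (dg_leibniz hb' hb hb2).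
rewrite (dg_leibnizl ha ha' ha2) (dg_leibnizl hb hb' hb2).
rewrite (dg_jacobi ha ha' ha2) (dg_jacobi hb hb' hb2) -!dg_mulA.
rewrite (dg_mulCA _ hb' hb) (dg_mulCA _ ha' ha).
(* Brackets {a',a} and {b',b} from {y,{x,z}} are turned round, so that cancelling terms become
   multiples of the same tensor. *)
rewrite (dg_br_anti ha' ha) (dg_br_anti hb' hb) -!scaleNr.
rewrite !(tensDl, tensDr, tensZl, tensZr, dg_mulZl, dg_mulZr).
rewrite !scalerDr !scalerA.
(* Terms 1 to 6 come from {{x,y},z} and 7 to 12 from {y,{x,z}}. The first eight places follow the
   order of the left side; the pairs 3, 10 and 5, 8 are put last, ready to cancel. *)
rewrite [RHS](AC (((1*2)*3)*((1*2)*3))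
  (((1*7)*(4*11))*((2*9)*(6*12))*((3*10)*(5*8)))) /=.
(* The cross terms a'{a,a''} (x) {b,b'}b'' and {a,a'}a'' (x) b'{b,b''} occur
   in both brackets on the right, with opposite signs by antisymmetry. *)
have cancel (c c' : k) t : c = - c' -> c *: t + c' *: t = 0 :> (A \ox B)%type.
  by move->; rewrite scaleNr addNr.
rewrite [X in _ = _ + (X + _)]cancel; last signz.
rewrite [X in _ = _ + (0 + X)]cancel ?add0r ?addr0; last signz.
by congr (_ *: _ + _ *: _ + (_ *: _ + _ *: _)
  + (_ *: _ + _ *: _ + (_ *: _ + _ *: _))); signz.
Qed.

Lemma tensor_dg_poisson :
  is_dg_poisson (@tensor_homog k A B) tensor_one tensor_mul tensor_br tensor_diff.
Proof.
split; [split; [split|..]|..].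
- exact: tensor_grading.
- exact: tensor_mul_bilinear.
- exact: tensor_mulA.
- exact: tensor_mul1l.
- exact: tensor_mul1r.
- exact: tensor_homog_tens (homog_one A) (homog_one B).
- exact: tensor_homog_mul.
- exact: tensor_diff_linear.
- exact: tensor_homog_diff.
- exact: tensor_diff_diff.
- exact: tensor_diff_mul.
- exact: tensor_mulC.
- exact: tensor_br_bilinear.
- exact: tensor_homog_br.
- exact: tensor_br_anti.
- exact: tensor_jacobi.
- exact: tensor_leibniz.
- exact: tensor_diff_br.
Qed.

Definition tensor_dgPoisson : dgPoisson k :=
  DGPoisson (DGPoissonOn tensor_dg_poisson).

End TensorOps.

(** * Tensor products of morphisms and associator *)

Local Notation "A \oxt B" := (tensor_dgPoisson A B)
  (at level 40, left associativity).

Local Arguments homog : simpl never.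
Local Arguments dg_one : simpl never.
Local Arguments dg_mul : simpl never.
Local Arguments dg_br : simpl never.
Local Arguments dg_diff : simpl never.

(** * Reduction of identities between morphisms to spanning families *)

Section Spanning.
Variable k : fieldType.
Implicit Types A B C D : dgPoisson k.

HB.instance Definition _ A B (f : dgp_hom A B) :=
  GRing.isLinear.Build k A B *:%R (dgp_fun f) (dgp_morph_linear (dgp_funP f)).

(** Spanning is encoded as an induction principle, so that a spanning family can serve directly as
    an eliminator for homogeneity. *)
Definition homog_spanned A (S : int -> A -> Prop) : Prop :=
  forall n (Q : A -> Prop), Q 0 -> (forall x y, Q x -> Q y -> Q (x + y)) ->
    (forall x, S n x -> Q x) -> forall x, homog A n x -> Q x.

Lemma homog_spanned_homog A : homog_spanned (homog A).
Proof. by move=> n Q _ _; apply. Qed.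

Lemma linear_span_eq A (V : lmodType k) (S : int -> A -> Prop)
    (f g : {linear A -> V}) :
  homog_spanned S -> (forall n x, S n x -> f x = g x) -> f =1 g.
Proof.
move=> Sspan fg; apply: (homog_ind (dgp_grading A)) => [|x y fgx fgy|n x].
- by rewrite !linear0.
- by rewrite !linearD fgx fgy.
move=> hx; elim/Sspan: hx => [|y z fgy fgz|y]; last exact: fg.
  by rewrite !linear0.
by rewrite !linearD fgy fgz.
Qed.

Lemma dgp_hom_span_eq A B (S : int -> A -> Prop) (f g : dgp_hom A B) :
  homog_spanned S -> (forall n x, S n x -> f x = g x) -> f = g.
Proof. by move=> Sspan fg; apply/dgp_hom_ext/(linear_span_eq Sspan fg). Qed.

(** Morphism laws are required of all elements, but the signed formulas of a tensor product are
    available only where degrees are known. Both sides of each law are linear in every variable, so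
    a spanning family is enough. *)
Lemma dgp_morphism_span A B (S : int -> A -> Prop) (f : {linear A -> B}) :
  homog_spanned S ->
  (forall n x, S n x -> homog B n (f x)) ->
  f (dg_one A) = dg_one B ->
  (forall m n x y, S m x -> S n y ->
    f (dg_mul A x y) = dg_mul B (f x) (f y)) ->
  (forall m n x y, S m x -> S n y ->
    f (dg_br A x y) = dg_br B (f x) (f y)) ->
  (forall n x, S n x -> f (dg_diff A x) = dg_diff B (f x)) ->
  is_dgp_morphism f.
Proof.
move=> Sspan fh f1 fM fbr fd; split=> //.
- by move=> c x y; rewrite linearP.
- move=> n x hx; elim/Sspan: hx => [|y z hy hz|y]; last exact: fh.
    by rewrite linear0; apply: homog0.
  by rewrite linearD; apply: homogD.
(* One variable at a time: for fixed y both sides are linear in x, and for x in the family they are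
   linear in y. *)
- move=> x y; suff /(_ x) : f \o applyr (dg_mul A) y =1 applyr (dg_mul B) (f y) \o f by [].
  apply: (linear_span_eq Sspan) => m {}x Sx /=.
  suff /(_ y) : f \o dg_mul A x =1 dg_mul B (f x) \o f by [].
  by apply: (linear_span_eq Sspan) => n {}y; apply: fM Sx.
- move=> x y; suff /(_ x) : f \o applyr (dg_br A) y =1 applyr (dg_br B) (f y) \o f by [].
  apply: (linear_span_eq Sspan) => m {}x Sx /=.
  suff /(_ y) : f \o dg_br A x =1 dg_br B (f x) \o f by [].
  by apply: (linear_span_eq Sspan) => n {}y; apply: fbr Sx.
- move=> x; suff /(_ x) : f \o dg_diff A =1 dg_diff B \o f by [].
  exact: (linear_span_eq Sspan).
Qed.

Lemma homog_tens A B i j a b :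
  homog A i a -> homog B j b -> homog (A \oxt B) (i + j) (a \ox b).
Proof. exact: tensor_homog_tens. Qed.

Lemma one_tens A B : dg_one (A \oxt B) = dg_one A \ox dg_one B.
Proof. by []. Qed.

Lemma mul_tens A B i' j (a a' : A) (b b' : B) : homog A i' a' -> homog B j b ->
  dg_mul (A \oxt B) (a \ox b) (a' \ox b')
  = (-1) ^ (i' * j) *: (dg_mul A a a' \ox dg_mul B b b').
Proof. exact: tensor_mulE. Qed.

Lemma br_tens A B i' j (a a' : A) (b b' : B) : homog A i' a' -> homog B j b ->
  dg_br (A \oxt B) (a \ox b) (a' \ox b')
  = (-1) ^ (i' * j) *: (dg_br A a a' \ox dg_mul B b b'
                        + dg_mul A a a' \ox dg_br B b b').
Proof. exact: tensor_brE. Qed.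

Lemma diff_tens A B i (a : A) (b : B) : homog A i a ->
  dg_diff (A \oxt B) (a \ox b)
  = dg_diff A a \ox b + (-1) ^ i *: (a \ox dg_diff B b).
Proof. exact: tensor_diffE. Qed.

(** The families on the two factors are parameters so that the construction iterates to any
    bracketing of several factors. *)
Definition pure_tensor A B (S : int -> A -> Prop) (S' : int -> B -> Prop)
    (n : int) (x : A \oxt B) : Prop :=
  exists i j a b, [/\ S i a, S' j b, i + j = n & x = a \ox b].

Lemma pure_tensor_spanned A B (S : int -> A -> Prop) (S' : int -> B -> Prop) :
  homog_spanned S -> homog_spanned S' -> homog_spanned (pure_tensor S S').
Proof.
move=> Sspan Sspan' n Q Q0 QD QS x hx.
elim/tensor_homog_ind: hx => // i j a b ha hb ij; rewrite -ij in QS.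
elim/Sspan: ha => [|a1 a2 Q1 Q2|{}a Sa].
- by rewrite tens0l.
- by rewrite tensDl; apply: QD.
elim/Sspan': hb => [|b1 b2 Q1 Q2|{}b Sb].
- by rewrite tens0r.
- by rewrite tensDr; apply: QD.
by apply: QS; exists i, j, a, b.
Qed.

Definition pure2 A B := @pure_tensor A B (homog A) (homog B).
Definition pure3 A B C := @pure_tensor (A \oxt B) C (@pure2 A B) (homog C).

Lemma pure2_spanned A B : homog_spanned (@pure2 A B).
Proof. by apply: pure_tensor_spanned; apply: homog_spanned_homog. Qed.

Lemma pure3_spanned A B C : homog_spanned (@pure3 A B C).
Proof.
by apply: pure_tensor_spanned (@pure2_spanned _ _) (@homog_spanned_homog _).
Qed.

(** The algebraic laws transfer to g by writing every argument as f of something and cancelling; the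
    degrees are handled by the hypothesis on g. *)
Lemma is_iso_can A B (f : dgp_hom A B) (g : B -> A) :
  cancel f g -> cancel g f -> (forall n b, homog B n b -> homog A n (g b)) ->
  @is_iso (dgPoissonCat k) A B f.
Proof.
move=> fK gK gh; have gP : is_dgp_morphism g.
  have [fl _ f1 fM fbr fd] := dgp_funP f; split=> //.
  - by move=> c x y; rewrite -{1}[x]gK -{1}[y]gK -fl fK.
  - by rewrite -f1 fK.
  - by move=> x y; rewrite -{1}[x]gK -{1}[y]gK -fM fK.
  - by move=> x y; rewrite -{1}[x]gK -{1}[y]gK -fbr fK.
  - by move=> x; rewrite -{1}[x]gK -fd fK.
by exists (DGPHom gP); split; apply: dgp_hom_ext.
Qed.

End Spanning.

Section Functor.
Variables (k : fieldType) (A A' B B' : dgPoisson k).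
Variables (f : dgp_hom A A') (g : dgp_hom B B').

Let tf : {linear (A \oxt B) -> (A' \oxt B')} := tmap f g.

Let fh := dgp_morph_homog (dgp_funP f).
Let gh := dgp_morph_homog (dgp_funP g).

Lemma tensor_map_morphism : is_dgp_morphism tf.
Proof.
apply: (dgp_morphism_span (@pure2_spanned _ A B)).
- move=> n _ [i [j [a [b [ha hb <- ->]]]]]; rewrite /tf /= tmapE /=.
  by apply: homog_tens; [apply: fh | apply: gh].
- by rewrite one_tens /tf /= tmapE /= !(dgp_morph1 (dgp_funP _)).
- move=> m n _ _ [i [j [a [b [ha hb _ ->]]]]] [i' [j' [a' [b' [ha' hb' _ ->]]]]].
  rewrite (mul_tens _ _ ha' hb) linearZ_LR /tf /= !tmapE /=.
  rewrite (mul_tens _ _ (fh ha') (gh hb)).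
  by rewrite (dgp_morphM (dgp_funP f)) (dgp_morphM (dgp_funP g)).
- move=> m n _ _ [i [j [a [b [ha hb _ ->]]]]] [i' [j' [a' [b' [ha' hb' _ ->]]]]].
  rewrite (br_tens _ _ ha' hb) linearZ_LR linearD /tf /= !tmapE /=.
  rewrite (br_tens _ _ (fh ha') (gh hb)).
  rewrite !(dgp_morphM (dgp_funP f)) !(dgp_morphM (dgp_funP g)).
  by rewrite (dgp_morph_br (dgp_funP f)) (dgp_morph_br (dgp_funP g)).
- move=> n _ [i [j [a [b [ha hb _ ->]]]]].
  rewrite (diff_tens _ ha) linearD linearZ_LR /tf /= !tmapE /=.
  rewrite (diff_tens _ (fh ha)).
  by rewrite (dgp_morph_diff (dgp_funP f)) (dgp_morph_diff (dgp_funP g)).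
Qed.

Definition dgp_tensor_map : dgp_hom (A \oxt B) (A' \oxt B') :=
  DGPHom tensor_map_morphism.

End Functor.

Section Associator.
Variables (k : fieldType) (A B C : dgPoisson k).

(** Reassociation leaves the factors in order, so no parity operator enters; signs appear only when
    comparing the structures. *)
Definition assoc_curry (x : A \oxt B) (c : C) : A \oxt (B \oxt C) :=
  tmap (@idfun A) (applyr (@tens k B C) c) x.

Lemma assoc_curry_bilinear : bilinear_for *:%R *:%R assoc_curry.
Proof.
split=> [c l x y|x l c c'] /=; first by rewrite /assoc_curry linearP.
by apply: tmap_linr => b; rewrite /= tensDr tensZr.
Qed.

Definition assoc_lin : {linear (A \oxt B \oxt C) -> (A \oxt (B \oxt C))} :=
  tlift assoc_curry_bilinear.

Lemma assoc_linE a b c : assoc_lin (a \ox b \ox c) = a \ox (b \ox c).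
Proof. by rewrite /assoc_lin tliftE /assoc_curry tmapE. Qed.

Let assocD x y : assoc_lin (x + y) = assoc_lin x + assoc_lin y.
Proof. exact: linearD. Qed.

Let assocZ c x : assoc_lin (c *: x) = c *: assoc_lin x.
Proof. exact: linearZ. Qed.

Definition unassoc_curry (a : A) (y : B \oxt C) : A \oxt B \oxt C :=
  tmap (@tens k A B a) (@idfun C) y.

Lemma unassoc_curry_bilinear : bilinear_for *:%R *:%R unassoc_curry.
Proof.
split=> [y l a a'|a l x y] /=; last by rewrite /unassoc_curry linearP.
by apply: tmap_linl => b; rewrite /= tensDl tensZl.
Qed.

Definition unassoc_lin : {linear (A \oxt (B \oxt C)) -> (A \oxt B \oxt C)} :=
  tlift unassoc_curry_bilinear.

Lemma unassoc_linE a b c : unassoc_lin (a \ox (b \ox c)) = a \ox b \ox c.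
Proof. by rewrite /unassoc_lin tliftE /unassoc_curry tmapE. Qed.

Lemma assoc_morphism : is_dgp_morphism assoc_lin.
Proof.
apply: (dgp_morphism_span (@pure3_spanned _ A B C)).
- move=> n _ [_ [l [_ [c [[i [j [a [b [ha hb <- ->]]]]] hc <- ->]]]]].
  by rewrite assoc_linE -addrA; do 2?apply: homog_tens.
- by rewrite !one_tens assoc_linE.
- move=> m n _ _ [_ [l [_ [c [[i [j [a [b [ha hb <- ->]]]]] hc _ ->]]]]]
    [_ [l' [_ [c' [[i' [j' [a' [b' [ha' hb' <- ->]]]]] hc' _ ->]]]]].
  rewrite (mul_tens _ _ (homog_tens ha' hb') hc) (mul_tens _ _ ha' hb).
  rewrite tensZl !assocZ !assoc_linE.
  rewrite (mul_tens _ _ ha' (homog_tens hb hc)) (mul_tens _ _ hb' hc).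
  (* Both exponents equal i'j + i'l + j'l. *)
  by rewrite tensZr !scalerA; congr (_ *: _); signz.
- move=> m n _ _ [_ [l [_ [c [[i [j [a [b [ha hb <- ->]]]]] hc _ ->]]]]]
    [_ [l' [_ [c' [[i' [j' [a' [b' [ha' hb' <- ->]]]]] hc' _ ->]]]]].
  rewrite (br_tens _ _ (homog_tens ha' hb') hc) (br_tens _ _ ha' hb).
  rewrite (mul_tens _ _ ha' hb) !(tensZl, tensDl) -scalerDr scalerA.
  rewrite assocZ !assocD !assoc_linE.
  rewrite (br_tens _ _ ha' (homog_tens hb hc)) (mul_tens _ _ hb' hc).
  rewrite (br_tens _ _ hb' hc) !(tensZr, tensDr) -scalerDr scalerA -addrA.
  by congr (_ *: _); signz.
- move=> n _ [_ [l [_ [c [[i [j [a [b [ha hb <- ->]]]]] hc _ ->]]]]].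
  rewrite (diff_tens _ (homog_tens ha hb)) (diff_tens _ ha) tensDl tensZl.
  rewrite !assocD !assocZ !assoc_linE (diff_tens _ ha) (diff_tens _ hb).
  by rewrite tensDr tensZr scalerDr scalerA addrA -expfzDr ?oppr_eq0 ?oner_eq0.
Qed.

Definition dgp_assoc : dgp_hom (A \oxt B \oxt C) (A \oxt (B \oxt C)) :=
  DGPHom assoc_morphism.

Lemma dgp_assoc_iso : @is_iso (dgPoissonCat k) _ _ dgp_assoc.
Proof.
apply: (is_iso_can (g := unassoc_lin)).
- suff: unassoc_lin \o assoc_lin =1 idfun by [].
  apply: (linear_span_eq (@pure3_spanned _ A B C)).
  move=> n _ [_ [l [_ [c [[i [j [a [b [_ _ _ ->]]]]] _ _ ->]]]]] /=.
  by rewrite assoc_linE unassoc_linE.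
- suff: assoc_lin \o unassoc_lin =1 idfun by [].
  apply: (linear_span_eq (pure_tensor_spanned (@homog_spanned_homog _ A)
    (@pure2_spanned _ B C))).
  move=> n _ [_ [l [a [_ [_ [i [j [b [c [_ _ _ ->]]]]] _ ->]]]]] /=.
  by rewrite unassoc_linE assoc_linE.
- move=> n x hx; elim/(pure_tensor_spanned (@homog_spanned_homog _ A)
    (@pure2_spanned _ B C)): hx => [|y z hy hz|].
  + by rewrite linear0; apply: homog0.
  + by rewrite linearD; apply: homogD.
  move=> _ [i [_ [a [_ [ha [j [l [b [c [hb hc <- ->]]]]] <- ->]]]]].
  by rewrite unassoc_linE addrA; do 2?apply: homog_tens.
Qed.

End Associator.

(** * Unitors, braiding and coherence *)

Section Unitors.
Variables (k : fieldType) (A : dgPoisson k).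
Local Notation I := (ground_dgPoisson k).

(** The zero scalar has every degree. Restricting to degree 0 still spans, and it makes the degree
    of the scalar factor literally 0, so that all signs in the unitors are trivial. *)
Definition ground_deg0 (n : int) (x : I) : Prop := n = 0.

Lemma ground_deg0_spanned : homog_spanned ground_deg0.
Proof. by move=> n Q Q0 _ QS x [n0|->]; [apply: QS | apply: Q0]. Qed.

Lemma homog_ground (l : I) : homog I 0 l.
Proof. by left. Qed.

Lemma left_unitor_bilinear :
  bilinear_for *:%R *:%R (fun (l : k^o) (a : A) => l *: a).
Proof.
split=> [a c l m|l c a a'] /=; first by rewrite scalerDl -scalerA.
by rewrite scalerDr !scalerA mulrC.
Qed.

Definition left_unitor_lin : {linear (I \oxt A) -> A} :=
  tlift left_unitor_bilinear.

Lemma left_unitor_linE (l : k^o) (a : A) : left_unitor_lin (l \ox a) = l *: a.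
Proof. exact: tliftE. Qed.

Lemma right_unitor_bilinear :
  bilinear_for *:%R *:%R (fun (a : A) (l : k^o) => l *: a).
Proof.
split=> [l c a a'|a c l m] /=; last by rewrite scalerDl -scalerA.
by rewrite scalerDr !scalerA mulrC.
Qed.

Definition right_unitor_lin : {linear (A \oxt I) -> A} :=
  tlift right_unitor_bilinear.

Lemma right_unitor_linE (a : A) (l : k^o) : right_unitor_lin (a \ox l) = l *: a.
Proof. exact: tliftE. Qed.

Let left_span := pure_tensor_spanned ground_deg0_spanned
  (@homog_spanned_homog _ A).
Let right_span := pure_tensor_spanned (@homog_spanned_homog _ A)
  ground_deg0_spanned.

Lemma left_unitor_morphism : is_dgp_morphism left_unitor_lin.
Proof.
have lD x y : left_unitor_lin (x + y) = left_unitor_lin x + left_unitor_lin y.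
  exact: linearD.
have lZ c x : left_unitor_lin (c *: x) = c *: left_unitor_lin x.
  exact: linearZ.
apply: (dgp_morphism_span left_span).
- move=> n _ [_ [j [l [a [-> ha <- ->]]]]].
  by rewrite left_unitor_linE add0r; apply: homogZ.
- by rewrite one_tens left_unitor_linE scale1r.
- move=> m n _ _ [_ [j [l [a [-> ha _ ->]]]]] [_ [j' [l' [a' [-> ha' _ ->]]]]].
  rewrite (mul_tens _ _ (homog_ground l') ha) mul0r expr0z scale1r.
  by rewrite !left_unitor_linE dg_mulZl dg_mulZr scalerA.
- move=> m n _ _ [_ [j [l [a [-> ha _ ->]]]]] [_ [j' [l' [a' [-> ha' _ ->]]]]].
  rewrite (br_tens _ _ (homog_ground l') ha) mul0r expr0z scale1r tens0l add0r.
  by rewrite !left_unitor_linE dg_brZl dg_brZr scalerA.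
- move=> n _ [_ [j [l [a [-> ha _ ->]]]]].
  rewrite (diff_tens _ (homog_ground l)) tens0l add0r expr0z scale1r.
  by rewrite !left_unitor_linE dg_diffZ.
Qed.

Lemma right_unitor_morphism : is_dgp_morphism right_unitor_lin.
Proof.
have rD x y : right_unitor_lin (x + y) = right_unitor_lin x + right_unitor_lin y.
  exact: linearD.
have rZ c x : right_unitor_lin (c *: x) = c *: right_unitor_lin x.
  exact: linearZ.
apply: (dgp_morphism_span right_span).
- move=> n _ [j [_ [a [l [ha -> <- ->]]]]].
  by rewrite right_unitor_linE addr0; apply: homogZ.
- by rewrite one_tens right_unitor_linE scale1r.
- move=> m n _ _ [j [_ [a [l [ha -> _ ->]]]]] [j' [_ [a' [l' [ha' -> _ ->]]]]].
  rewrite (mul_tens _ _ ha' (homog_ground l)) mulr0 expr0z scale1r.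
  by rewrite !right_unitor_linE dg_mulZl dg_mulZr scalerA.
- move=> m n _ _ [j [_ [a [l [ha -> _ ->]]]]] [j' [_ [a' [l' [ha' -> _ ->]]]]].
  rewrite (br_tens _ _ ha' (homog_ground l)) mulr0 expr0z scale1r tens0r addr0.
  by rewrite !right_unitor_linE dg_brZl dg_brZr scalerA.
- move=> n _ [j [_ [a [l [ha -> _ ->]]]]].
  rewrite (diff_tens _ ha) tens0r scaler0 addr0.
  by rewrite !right_unitor_linE dg_diffZ.
Qed.

Definition dgp_left_unitor : dgp_hom (I \oxt A) A := DGPHom left_unitor_morphism.
Definition dgp_right_unitor : dgp_hom (A \oxt I) A := DGPHom right_unitor_morphism.

Lemma dgp_left_unitor_iso : @is_iso (dgPoissonCat k) _ _ dgp_left_unitor.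
Proof.
apply: (@is_iso_can _ _ _ dgp_left_unitor (fun a : A => (1 : k^o) \ox a)).
- suff: @tens k k^o A 1 \o left_unitor_lin =1 idfun by [].
  apply: (linear_span_eq left_span) => n _ [_ [j [l [a [_ _ _ ->]]]]] /=.
  by rewrite left_unitor_linE tensZr -tensZl /GRing.scale /= mulr1.
- by move=> a; rewrite /= left_unitor_linE scale1r.
- by move=> n a ha; rewrite -[n]add0r; apply: homog_tens ha; apply: homog_ground.
Qed.

Lemma dgp_right_unitor_iso : @is_iso (dgPoissonCat k) _ _ dgp_right_unitor.
Proof.
apply: (@is_iso_can _ _ _ dgp_right_unitor (fun a : A => a \ox (1 : k^o))).
- suff: applyr (@tens k A k^o) 1 \o right_unitor_lin =1 idfun by [].
  apply: (linear_span_eq right_span) => n _ [j [_ [a [l [_ _ _ ->]]]]] /=.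
  by rewrite right_unitor_linE tensZl -tensZr /GRing.scale /= mulr1.
- by move=> a; rewrite /= right_unitor_linE scale1r.
- by move=> n a ha; rewrite -[n]addr0; apply: homog_tens => //; apply: homog_ground.
Qed.

End Unitors.

Section Braiding.
Variables (k : fieldType) (A B : dgPoisson k).

Definition braid_pure (a : A) (b : B) : B \oxt A :=
  parity_part false b \ox a + parity_part true b \ox sign_twist a.

Lemma braid_pure_bilinear : bilinear_for *:%R *:%R braid_pure.
Proof.
split=> [b c a a'|a c b b'] /=; rewrite /braid_pure.
  by rewrite (linearP (@sign_twist k A)) /= !tensDr !tensZr scalerDr addrACA.
by rewrite !(linearP (@parity_part k B _)) /= !tensDl !tensZl scalerDr addrACA.
Qed.

Definition braid_lin : {linear (A \oxt B) -> (B \oxt A)} :=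
  tlift braid_pure_bilinear.

Lemma braid_linE i j (a : A) (b : B) : homog A i a -> homog B j b ->
  braid_lin (a \ox b) = (-1) ^ (i * j) *: (b \ox a).
Proof.
move=> ha hb; rewrite /braid_lin tliftE /braid_pure (sign_twistE ha).
rewrite !(parity_part_homog _ hb) !signzE tensZr.
case: (oddz j); rewrite /= tens0l ?scaler0 ?add0r ?addr0 ?andbT //.
by rewrite andbF expr0 scale1r.
Qed.

Lemma braid_morphism : is_dgp_morphism braid_lin.
Proof.
have bD x y : braid_lin (x + y) = braid_lin x + braid_lin y by exact: linearD.
have bZ c x : braid_lin (c *: x) = c *: braid_lin x by exact: linearZ.
apply: (dgp_morphism_span (@pure2_spanned _ A B)).
- move=> n _ [i [j [a [b [ha hb <- ->]]]]]; rewrite (braid_linE ha hb) addrC.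
  by apply/homogZ/homog_tens.
- rewrite !one_tens (braid_linE (homog_one A) (homog_one B)).
  by rewrite mulr0 expr0z scale1r.
- move=> m n _ _ [i [j [a [b [ha hb _ ->]]]]] [i' [j' [a' [b' [ha' hb' _ ->]]]]].
  rewrite (mul_tens _ _ ha' hb) bZ (braid_linE (homog_mul ha ha') (homog_mul hb hb')).
  rewrite (braid_linE ha hb) (braid_linE ha' hb') dg_mulZl dg_mulZr.
  (* On the left, i'j occurs twice, once from the product and once from the braiding, so modulo 2
     both sides have exponent ij + ij' + i'j'. *)
  by rewrite (mul_tens _ _ hb' ha) !scalerA; congr (_ *: _); signz.
- move=> m n _ _ [i [j [a [b [ha hb _ ->]]]]] [i' [j' [a' [b' [ha' hb' _ ->]]]]].
  rewrite (br_tens _ _ ha' hb) bZ bD (braid_linE (homog_br ha ha') (homog_mul hb hb')).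
  rewrite (braid_linE (homog_mul ha ha') (homog_br hb hb')) -scalerDr.
  rewrite (braid_linE ha hb) (braid_linE ha' hb') dg_brZl dg_brZr.
  (* Exchanging the factors also exchanges the two summands of the bracket. *)
  by rewrite (br_tens _ _ hb' ha) !scalerA; congr (_ *: _); [signz | rewrite addrC].
- move=> n _ [i [j [a [b [ha hb _ ->]]]]].
  rewrite (diff_tens _ ha) bD bZ (braid_linE (homog_diff ha) hb).
  rewrite (braid_linE ha (homog_diff hb)) (braid_linE ha hb) dg_diffZ.
  rewrite (diff_tens _ hb) scalerDr !scalerA [LHS]addrC.
  by congr (_ *: _ + _ *: _); signz.
Qed.

Definition dgp_braid : dgp_hom (A \oxt B) (B \oxt A) := DGPHom braid_morphism.

Lemma dgp_braidE i j (a : A) (b : B) : homog A i a -> homog B j b ->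
  dgp_braid (a \ox b) = (-1) ^ (i * j) *: (b \ox a).
Proof. exact: braid_linE. Qed.

End Braiding.

(** * Naturality and coherence diagrams *)

Section Coherence.
Variable k : fieldType.
Implicit Types X Y Z T : dgPoisson k.
Local Notation I := (ground_dgPoisson k).
Local Notation "g \oc f" := (dgp_comp g f) (at level 50).
Local Notation "f \ot g" := (dgp_tensor_map f g) (at level 40).

Lemma dgp_homZ X Y (f : dgp_hom X Y) c x : f (c *: x) = c *: f x.
Proof. exact: linearZ. Qed.

Lemma dgp_compE X Y Z (g : dgp_hom Y Z) (f : dgp_hom X Y) x :
  (g \oc f) x = g (f x).
Proof. by []. Qed.

Lemma dgp_tensor_mapE X X' Y Y' (f : dgp_hom X X') (g : dgp_hom Y Y') x y :
  (f \ot g) (x \ox y) = f x \ox g y.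
Proof. exact: tmapE. Qed.

Lemma dgp_assocE X Y Z (x : X) (y : Y) (z : Z) :
  dgp_assoc X Y Z (x \ox y \ox z) = x \ox (y \ox z).
Proof. exact: assoc_linE. Qed.

Lemma dgp_left_unitorE X (l : I) (x : X) :
  dgp_left_unitor X (l \ox x) = (l : k^o) *: x.
Proof. exact: left_unitor_linE. Qed.

Lemma dgp_right_unitorE X (x : X) (l : I) :
  dgp_right_unitor X (x \ox l) = (l : k^o) *: x.
Proof. exact: right_unitor_linE. Qed.

Lemma dgp_tensor_eq X Y T (f g : dgp_hom (X \oxt Y) T) :
  (forall i j x y, homog X i x -> homog Y j y -> f (x \ox y) = g (x \ox y)) ->
  f = g.
Proof.
move=> fg; apply: (dgp_hom_span_eq (@pure2_spanned _ X Y)).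
by move=> n _ [i [j [x [y [hx hy _ ->]]]]]; apply: fg hx hy.
Qed.

Lemma dgp_tensor3_eq X Y Z T (f g : dgp_hom (X \oxt Y \oxt Z) T) :
  (forall i j l x y z, homog X i x -> homog Y j y -> homog Z l z ->
    f (x \ox y \ox z) = g (x \ox y \ox z)) -> f = g.
Proof.
move=> fg; apply: (dgp_hom_span_eq (@pure3_spanned _ X Y Z)).
move=> n _ [_ [l [_ [z [[i [j [x [y [hx hy _ ->]]]]] hz _ ->]]]]].
exact: fg hx hy hz.
Qed.

Lemma dgp_tensor_map_id X Y : dgp_id X \ot dgp_id Y = dgp_id (X \oxt Y).
Proof. by apply: dgp_tensor_eq => i j x y _ _; rewrite dgp_tensor_mapE. Qed.

Lemma dgp_tensor_map_comp X X' X'' Y Y' Y'' (f' : dgp_hom X' X'')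
    (f : dgp_hom X X') (g' : dgp_hom Y' Y'') (g : dgp_hom Y Y') :
  (f' \oc f) \ot (g' \oc g) = (f' \ot g') \oc (f \ot g).
Proof.
by apply: dgp_tensor_eq => i j x y _ _; rewrite !(dgp_compE, dgp_tensor_mapE).
Qed.

Lemma dgp_assoc_natural X X' Y Y' Z Z' (f : dgp_hom X X') (g : dgp_hom Y Y')
    (h : dgp_hom Z Z') :
  dgp_assoc X' Y' Z' \oc ((f \ot g) \ot h)
  = (f \ot (g \ot h)) \oc dgp_assoc X Y Z.
Proof.
apply: dgp_tensor3_eq => i j l x y z _ _ _.
by rewrite !(dgp_compE, dgp_assocE, dgp_tensor_mapE).
Qed.

Lemma dgp_left_unitor_natural X X' (f : dgp_hom X X') :
  dgp_left_unitor X' \oc (dgp_id I \ot f) = f \oc dgp_left_unitor X.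
Proof.
apply: dgp_tensor_eq => i j l x _ _.
by rewrite !dgp_compE dgp_tensor_mapE !dgp_left_unitorE dgp_homZ.
Qed.

Lemma dgp_right_unitor_natural X X' (f : dgp_hom X X') :
  dgp_right_unitor X' \oc (f \ot dgp_id I) = f \oc dgp_right_unitor X.
Proof.
apply: dgp_tensor_eq => i j x l _ _.
by rewrite !dgp_compE dgp_tensor_mapE !dgp_right_unitorE dgp_homZ.
Qed.

Lemma dgp_braid_natural X X' Y Y' (f : dgp_hom X X') (g : dgp_hom Y Y') :
  dgp_braid X' Y' \oc (f \ot g) = (g \ot f) \oc dgp_braid X Y.
Proof.
apply: dgp_tensor_eq => i j x y hx hy; rewrite !dgp_compE dgp_tensor_mapE.
rewrite (dgp_braidE hx hy) dgp_homZ dgp_tensor_mapE.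
by rewrite (dgp_braidE (dgp_morph_homog (dgp_funP f) hx)
              (dgp_morph_homog (dgp_funP g) hy)).
Qed.

Lemma dgp_pentagon X Y Z T :
  dgp_assoc X Y (Z \oxt T) \oc dgp_assoc (X \oxt Y) Z T
  = (dgp_id X \ot dgp_assoc Y Z T)
      \oc (dgp_assoc X (Y \oxt Z) T \oc (dgp_assoc X Y Z \ot dgp_id T)).
Proof.
apply: (dgp_hom_span_eq (pure_tensor_spanned (@pure3_spanned _ X Y Z)
  (@homog_spanned_homog _ T))).
move=> n _ [_ [m [_ [t [[_ [l [_ [z [[i [j [x [y [_ _ _ ->]]]]] _ _ ->]]]]] _ _ ->]]]]].
by rewrite !(dgp_compE, dgp_tensor_mapE, dgp_assocE).
Qed.

Lemma dgp_triangle X Y :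
  (dgp_id X \ot dgp_left_unitor Y) \oc dgp_assoc X I Y
  = dgp_right_unitor X \ot dgp_id Y.
Proof.
apply: dgp_tensor3_eq => i j l x c y _ _ _.
rewrite !(dgp_compE, dgp_tensor_mapE, dgp_assocE) dgp_left_unitorE dgp_right_unitorE.
by rewrite tensZl tensZr.
Qed.

(** Moving x past y and z at once costs i(j+l), and one after the other ij + il. *)
Lemma dgp_hexagon X Y Z :
  dgp_assoc Y Z X \oc (dgp_braid X (Y \oxt Z) \oc dgp_assoc X Y Z)
  = (dgp_id Y \ot dgp_braid X Z)
      \oc (dgp_assoc Y X Z \oc (dgp_braid X Y \ot dgp_id Z)).
Proof.
apply: dgp_tensor3_eq => i j l x y z hx hy hz.
rewrite !(dgp_compE, dgp_tensor_mapE, dgp_assocE) (dgp_braidE hx (homog_tens hy hz)).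
rewrite (dgp_braidE hx hy) tensZl !dgp_homZ !dgp_assocE dgp_tensor_mapE.
rewrite (dgp_braidE hx hz) tensZr scalerA; congr (_ *: _); signz.
Qed.

Lemma dgp_braid_symmetric X Y :
  dgp_braid Y X \oc dgp_braid X Y = dgp_id (X \oxt Y).
Proof.
apply: dgp_tensor_eq => i j x y hx hy.
rewrite dgp_compE (dgp_braidE hx hy) dgp_homZ (dgp_braidE hy hx) scalerA.
rewrite -[RHS]scale1r; congr (_ *: _); signz.
Qed.

Definition dgp_symmetric_monoidal :
  @symmetric_monoidal (dgPoissonCat k) (@tensor_dgPoisson k) I :=
  @SymmetricMonoidal (dgPoissonCat k) (@tensor_dgPoisson k) I
    (@dgp_tensor_map k) (@dgp_assoc k) (@dgp_left_unitor k)
    (@dgp_right_unitor k) (@dgp_braid k)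
    dgp_tensor_map_id dgp_tensor_map_comp
    dgp_assoc_natural dgp_left_unitor_natural dgp_right_unitor_natural
    dgp_braid_natural
    (@dgp_assoc_iso k) (@dgp_left_unitor_iso k) (@dgp_right_unitor_iso k)
    dgp_pentagon dgp_triangle dgp_hexagon dgp_braid_symmetric.

End Coherence.

(** The existential witnesses are pinned down by their values on pure tensors, so the statement
    concerns the standard tensor product and the standard structure maps, the braiding being the
    signed symmetry. *)
Theorem proposition2p10 (k : fieldType) :
  exists T : forall A B : dgPoisson k, dgPoisson_on (A \ox B)%type,
    (forall A B : dgPoisson k,
      [/\ forall n x, homog (T A B) n x <-> tensor_homog n x,
          dg_one (T A B) = dg_one A \ox dg_one B,
          forall i j i' j' (a a' : A) (b b' : B),
            homog A i a -> homog B j b -> homog A i' a' -> homog B j' b' ->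
            dg_mul (T A B) (a \ox b) (a' \ox b')
            = (-1) ^ (i' * j) *: (dg_mul A a a' \ox dg_mul B b b'),
          forall i j (a : A) (b : B), homog A i a -> homog B j b ->
            dg_diff (T A B) (a \ox b)
            = dg_diff A a \ox b + (-1) ^ i *: (a \ox dg_diff B b)
        & forall i j i' j' (a a' : A) (b b' : B),
            homog A i a -> homog B j b -> homog A i' a' -> homog B j' b' ->
            dg_br (T A B) (a \ox b) (a' \ox b')
            = (-1) ^ (i' * j) *: (dg_br A a a' \ox dg_mul B b b'
                                  + dg_mul A a a' \ox dg_br B b b')])
    /\
    exists M : @symmetric_monoidal (dgPoissonCat k)
                 (fun A B => DGPoisson (T A B)) (ground_dgPoisson k),
      [/\ forall (A A' B B' : dgPoisson k) (f : dgp_hom A A') (g : dgp_hom B B')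
            (a : A) (b : B),
            (tensor_map M f g : dgp_hom _ _) (a \ox b) = f a \ox g b,
          forall (A B C : dgPoisson k) (a : A) (b : B) (c : C),
            (associator M A B C : dgp_hom _ _) (a \ox b \ox c)
            = a \ox (b \ox c),
          forall (A : dgPoisson k) (l : k) (a : A),
            (left_unitor M A : dgp_hom _ _) ((l : k^o) \ox a) = l *: a,
          forall (A : dgPoisson k) (a : A) (l : k),
            (right_unitor M A : dgp_hom _ _) (a \ox (l : k^o)) = l *: a
        & forall (A B : dgPoisson k) i j (a : A) (b : B),
            homog A i a -> homog B j b ->
            (braiding M A B : dgp_hom _ _) (a \ox b)
            = (-1) ^ (i * j) *: (b \ox a)].
Proof.
exists (fun A B => DGPoissonOn (tensor_dg_poisson A B)); split=> [A B|].
  split=> //.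
  - by move=> i j i' j' a a' b b' _ hb ha' _; apply: tensor_mulE.
  - by move=> i j a b ha _; apply: tensor_diffE.
  - by move=> i j i' j' a a' b b' _ hb ha' _; apply: tensor_brE.
exists (dgp_symmetric_monoidal k); split.
- exact: dgp_tensor_mapE.
- exact: dgp_assocE.
- exact: dgp_left_unitorE.
- exact: dgp_right_unitorE.
- exact: dgp_braidE.
Qed.
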